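(* $L(12453)=(1+\sqrt{8})^2=9+4\sqrt{2}$.
   Context: A permutation $p=p_1\cdots p_n$ of $[n]=\{1,\dots,n\}$ contains a pattern $q=q_1\cdots q_k$ (a permutation of $[k]$) if there are indices $i_1<\dots<i_k$ with $p_{i_a}<p_{i_b}$ iff $q_a<q_b$; otherwise $p$ avoids $q$. $S_n(q)$ denotes the number of permutations of length $n$ avoiding $q$, and $L(q)=\lim_{n\to\infty}\sqrt[n]{S_n(q)}$ (this limit is known to exist for every pattern $q$). *)

(* Defs.v *)
From mathcomp Require Import all_boot all_order all_algebra all_fingroup.
From mathcomp Require Import all_classical all_reals all_analysis.

Set Implicit Arguments.
Unset Strict Implicit.
Unset Printing Implicit Defensive.

Import Order.TTheory GRing.Theory Num.Theory.
Import numFieldNormedType.Exports.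

Local Open Scope ring_scope.

(* Permutations of [n] are elements of 'S_n, so positions and values are
   numbered 0, ..., n-1 instead of 1, ..., n.  The function f is the choice of
   positions i_1 < ... < i_k. *)
Definition contains_pattern (n k : nat) (p : 'S_n) (q : 'S_k) : bool :=
  [exists f : {ffun 'I_k -> 'I_n},
    [forall a : 'I_k, forall b : 'I_k, (a < b)%N ==> (f a < f b)%N] &&
    [forall a : 'I_k, forall b : 'I_k, (p (f a) < p (f b))%N == (q a < q b)%N]].

Definition avoids (n k : nat) (p : 'S_n) (q : 'S_k) : bool :=
  ~~ contains_pattern p q.

Definition num_avoiding (k : nat) (q : 'S_k) (n : nat) : nat :=
  #|[set p : 'S_n | avoids p q]|.

(* For n = 0 the exponent is 0^-1 = 0; this term is irrelevant to the limit. *)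
Definition avoiding_root (R : realType) (k : nat) (q : 'S_k) (n : nat) : R :=
  (num_avoiding q n)%:R `^ n%:R^-1.

(* limn returns an unspecified value on divergent sequences, so this is
   meaningful only together with cvgn (avoiding_root R q). *)
Definition growth_rate (R : realType) (k : nat) (q : 'S_k) : R :=
  limn (avoiding_root R q).

(* One-line notation, shifted to values 0, ..., 4. *)
Definition word12453 (i : 'I_5) : 'I_5 :=
  inord (nth 0%N [:: 1; 2; 4; 5; 3]%N i).-1.

Lemma word12453_inj : injective word12453.
Proof.
move=> i j /(congr1 val); rewrite /word12453.
by case: i j => [[|[|[|[|[|i]]]]] Hi] [[|[|[|[|[|j]]]]] Hj] //=;
   rewrite !inordK // => _; apply: val_inj.
Qed.

Definition pat12453 : 'S_5 := perm word12453_inj.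

Lemma pat12453E : [seq (val (pat12453 i)).+1 | i <- enum 'I_5] =
  [:: 1; 2; 4; 5; 3]%N.
Proof.
have -> : [seq (val (pat12453 i)).+1 | i <- enum 'I_5] =
          [seq (nth 0 [:: 1; 2; 4; 5; 3] (val i)).-1.+1 | i <- enum 'I_5]%N.
  apply: eq_map => i; rewrite permE /word12453 /= inordK //.
  by case: i => [[|[|[|[|[|i]]]]] Hi].
by rewrite (map_comp (fun i => (nth 0 [:: 1; 2; 4; 5; 3] i).-1.+1)%N val)
   val_enum_ord.
Qed.

(* Main.v *)
(* A permutation avoids 12453 iff its entries that are not left-to-right minima
   avoid 1342.  The minima are determined by their positions and their values,
   so S_m(1342) <= 8^m gives at most
     sum_k C(n,k)^2 8^(n-k) <= (1 + sqrt 8)^(2n)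
   permutations of length n.  Conversely, insert k minima into a skew sum of
   1342-avoiders of length t: they all stay minima when their staircase keeps a
   distance t from the antidiagonal, and by rotating the lattice path of the
   staircase this happens for at least a fraction 1/k of the C(n,k)^2 choices of
   positions and values.  With S_t(1342) >= 8^t / poly(t) the bounds meet.

   For 1342 itself, read a word from left to right.  The entries still to come
   that exceed the running minimum avoid 231, and only the lengths of their
   decreasing runs matter: a value that falls below the running minimum splits
   the first run, and reading a pending entry shortens it.  The resulting
   quadratic equation with one catalytic variable is solved by
   z = rho (1 - 2 rho), sum_m S_m z^m = (1 - 2 rho) / (1 - rho)^3. *)

Require Import Defs.
From mathcomp Require Import all_boot all_order all_algebra all_fingroup.
From mathcomp Require Import all_classical all_reals all_analysis.
From mathcomp Require Import qpoly ring lra zify.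

Set Implicit Arguments.
Unset Strict Implicit.
Unset Printing Implicit Defensive.

Import Order.TTheory GRing.Theory Num.Theory.
Import numFieldNormedType.Exports.
Import Pdiv.CommonRing Pdiv.RingMonic.

(** * Scanning words that avoid 1342 *)

(** The upper and the lower estimate differ only by factors polynomial in n. Positions and values of
    the minima are chosen independently, so each estimate involves squares of the terms of (1 +
    v)^n; both the sum of these squares and the largest of them can be compared with the square of
    the sum. For the lower bound the block length t is fixed before n grows: v is any number below
    sqrt 8, t is chosen with S_t(1342) >= v^(2t), and padding whose length depends only on t costs a
    constant factor. Many short blocks replace one long avoider because the entries of their skew
    sum stay within distance t of the antidiagonal.

    Instead of formal power series, generating functions are evaluated at an element Z of a
    commutative ring with Z^n = 0, later the class of X modulo a power of X. Two solutions of a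
    recursion that multiplies by Z then agree after finitely many steps. *)

Definition avoid231 (s : seq nat) : Prop := forall b c d : nat,
  subseq [:: b; c; d] s -> ~~ [&& d < b & b < c].

Definition avoid1342 (s : seq nat) : Prop := forall a b c d : nat,
  subseq [:: a; b; c; d] s -> ~~ [&& a < d, d < b & b < c].

(** The lengths of the maximal decreasing runs of adjacent entries, from left to right. *)
Fixpoint runs (s : seq nat) : seq nat :=
  if s is x :: s' then
    if s' is y :: _ then
      if y < x then (head 0 (runs s')).+1 :: behead (runs s') else 1 :: runs s'
    else [:: 1]
  else [::].

Definition ins (j m : nat) (s : seq nat) : seq nat := take j s ++ m :: drop j s.

(* [completions m s] lists what can remain to be read when [0, ..., m-1] are
   the values below the running minimum and [s] is the order in which the
   values above it will occur.  The next letter is the head of [s], or the new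
   minimum [m-1], or lies below [m-1]; in the last case [m-1] first joins the
   pending values.  [low_completions] keeps the last two cases. *)
Fixpoint completions_rec (e : seq (seq nat)) (low : seq nat -> seq (seq nat)) (s : seq nat) :=
  (if s is x :: s' then [seq x :: q | q <- completions_rec e low s'] else e) ++ low s.

Fixpoint low_completions (m : nat) (s : seq nat) : seq (seq nat) :=
  if m is m'.+1 then
    [seq m' :: q | q <- completions_rec (nseq (m' == 0) [::]) (low_completions m') s] ++
    flatten [seq low_completions m' (ins j m' s) | j <- iota 0 (head 0 (runs s)).+1]
  else [::].

Definition completions (m : nat) : seq nat -> seq (seq nat) :=
  completions_rec (nseq (m == 0) [::]) (low_completions m).

Lemma completions_nil m : completions m [::] = nseq (m == 0) [::] ++ low_completions m [::].
Proof. by []. Qed.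

Lemma completions_cons m x s :
  completions m (x :: s) = [seq x :: q | q <- completions m s] ++ low_completions m (x :: s).
Proof. by []. Qed.

Lemma low_completionsS m s : low_completions m.+1 s =
  [seq m :: q | q <- completions m s] ++
  flatten [seq low_completions m (ins j m s) | j <- iota 0 (head 0 (runs s)).+1].
Proof. by []. Qed.

Arguments completions : simpl never.

Lemma all_cons (T : Type) (P : pred T) x s : all P (x :: s) = P x && all P s.
Proof. by []. Qed.

Lemma runs_cons2 x y s : runs [:: x, y & s] =
  if y < x then (head 0 (runs (y :: s))).+1 :: behead (runs (y :: s))
  else 1 :: runs (y :: s).
Proof. by []. Qed.

Lemma runs_seq1 x : runs [:: x] = [:: 1].
Proof. by []. Qed.

Arguments runs : simpl never.

Lemma runs_cons_neq0 x s : runs (x :: s) = head 0 (runs (x :: s)) :: behead (runs (x :: s)).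
Proof. by case: s => // y s; rewrite runs_cons2; case: ifP. Qed.

Lemma ins0 m s : ins 0 m s = m :: s.
Proof. by rewrite /ins take0 drop0. Qed.

Lemma insS j m x s : ins j.+1 m (x :: s) = x :: ins j m s.
Proof. by []. Qed.

(** Being smaller than all of [s], the letter [m] closes a run: it prolongs the first [j] entries
    and is followed by an ascent. A remainder of length 0 is dropped. *)
Lemma runs_ins j m s : all (fun x => m < x) s -> j <= head 0 (runs s) ->
  runs (ins j m s) = j.+1 ::
    (if head 0 (runs s) - j == 0 then behead (runs s)
     else (head 0 (runs s) - j) :: behead (runs s)).
Proof.
elim: j s => [|j IH] s.
  rewrite ins0 subn0; case: s => [|x s] //= /andP[mx _] _.
  rewrite runs_cons2 ltnNge ltnW //= {1 2}runs_cons_neq0 /=.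
  case: s => [|y s] //; by rewrite runs_cons2; case: ifP.
case: s => [|x s] //; rewrite all_cons insS => /andP[mx ms].
case: s ms => [|y s] ms.
  by rewrite runs_seq1 /= ltnS leqn0 => /eqP ->; rewrite ins0 runs_cons2 mx.
rewrite runs_cons2; case: ifP => [yx|yx].
  rewrite /= ltnS subSS => lej.
  have [z [s' [E zx]]] : exists z s', ins j m (y :: s) = z :: s' /\ z < x.
    case: (j) => [|j']; first by exists m, (y :: s).
    by exists y, (ins j' m s).
  by rewrite E runs_cons2 zx -E (IH _ ms lej).
rewrite /= ltnS leqn0 => /eqP ->; rewrite ins0 runs_cons2 mx /=.
move: ms; rewrite all_cons => /andP[my _].
by rewrite runs_cons2 ltnNge ltnW.
Qed.

Lemma head_runs_le s : head 0 (runs s) <= size s.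
Proof.
by elim: s => // x [|y s] IH //; rewrite runs_cons2; case: ifP.
Qed.

Lemma avoid231_cons x s : avoid231 (x :: s) -> avoid231 s.
Proof. by move=> H b c d sub; apply: H; apply: subseq_trans sub (subseq_cons _ _). Qed.

Lemma avoid1342_cons x s : avoid1342 (x :: s) -> avoid1342 s.
Proof. by move=> H a b c d sub; apply: H; apply: subseq_trans sub (subseq_cons _ _). Qed.

Lemma sub_avoid231 s s' : subseq s' s -> avoid231 s -> avoid231 s'.
Proof. by move=> ss H b c d sub; apply: H; apply: subseq_trans sub ss. Qed.

Lemma avoid1342_consE x s : avoid1342 s ->
  avoid231 [seq y <- s | x < y] -> avoid1342 (x :: s).
Proof.
move=> H1 H2 a b c d.
rewrite /= ; case: eqP => [->|_] sub; last exact: H1.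
apply/negP => /and3P[xd db bc].
have : subseq [:: b; c; d] [seq y <- s | x < y].
  by rewrite subseq_filter sub /= xd !andbT; apply/andP; split; lia.
by move/H2; rewrite db bc.
Qed.

(* Before the new minimum [m] only a decreasing prefix is allowed, otherwise
   [m] plays the role of 1 in 231. *)
Lemma avoid231_ins j m s : uniq s -> all (fun x => m < x) s -> j <= size s ->
  avoid231 (ins j m s) -> j <= head 0 (runs s).
Proof.
elim: j s => // j IH [|x s] //; rewrite all_cons cons_uniq insS.
move=> /andP[xs us] /andP[mx ms] js H.
have lej := IH _ us ms js (avoid231_cons H).
case: s {js} xs us ms H lej IH => [|y s] xs us ms H lej IH.
  by move: lej; rewrite leqn0 => /eqP ->.
rewrite runs_cons2; case: ifP => yx //=; rewrite ltnS leqNgt; apply/negP => j0.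
have xy : x < y by move: xs yx; rewrite inE negb_or => /andP[/eqP]; lia.
have : subseq [:: x; y; m] (x :: ins j m (y :: s)).
  case: j j0 {IH lej H} => // j _.
  by rewrite insS /= !eqxx sub1seq mem_cat inE eqxx orbT.
by move/H; rewrite mx xy.
Qed.

Lemma subseq_cons_catr (T : eqType) (m : T) t u v :
  m \notin v -> subseq (m :: t) (v ++ m :: u) -> subseq t u.
Proof.
elim: v => [|x v IH] /=; first by rewrite eqxx.
by rewrite inE negb_or => /andP[/negPf -> /IH].
Qed.

Lemma subseq_rcons_catl (T : eqType) (m : T) t u v :
  m \notin v -> subseq (rcons t m) (u ++ m :: v) -> subseq t u.
Proof.
move=> mv; rewrite -subseq_rev rev_rcons rev_cat rev_cons cat_rcons.
by move/subseq_cons_catr; rewrite mem_rev subseq_rev => /(_ mv).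
Qed.

Lemma runs_desc s : path.sorted gtn (take (head 0 (runs s)) s).
Proof.
elim: s => [|x [|y s] IH] //.
rewrite runs_cons2; case: ifP => // yx /=.
move: IH; rewrite runs_cons_neq0 /=.
by case: (head 0 _) => [|n] //= ->; rewrite andbT.
Qed.

(** The smallest letter [m] can only be the 1 of a 231, and the entries before it are decreasing, so
    the ascent 23 is missing. *)
Lemma ins_avoid231 j m s : all (fun x => m < x) s -> j <= head 0 (runs s) ->
  avoid231 s -> avoid231 (ins j m s).
Proof.
move=> ms lej H b c d sub; apply/negP => /andP[db bc].
have fE : [seq x <- ins j m s | m < x] = s.
  rewrite /ins filter_cat /= ltnn.
  by rewrite -filter_cat cat_take_drop; apply/all_filterP.
have nm : (d == m).
  apply/negPn/negP => dm.
  have mem : d \in ins j m s by apply: (mem_subseq sub); rewrite !inE eqxx !orbT.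
  have md : m < d.
    move: mem; rewrite /ins mem_cat inE (negPf dm) /= -mem_cat cat_take_drop.
    by move/(allP ms).
  have : subseq [:: b; c; d] s.
    by rewrite -fE subseq_filter sub /= md !andbT; apply/andP; split; lia.
  by move/H; rewrite db bc.
move/eqP in nm; subst d.
have st : path.sorted gtn (take j s).
  have -> : take j s = take j (take (head 0 (runs s)) s) by rewrite take_takel.
  exact: (take_sorted _ (runs_desc s)).
have : subseq [:: b; c] (take j s).
  apply: (@subseq_rcons_catl _ m _ _ (drop j s)); last exact: sub.
  by apply/negP => /mem_drop /(allP ms); rewrite ltnn.
have gt_trans : transitive gtn by move=> x y z /=; lia.
move/(subseq_sorted gt_trans)/(_ st) => /=; lia.
Qed.

Definition walk_spec (m : nat) (s q : seq nat) : Prop :=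
  [/\ perm_eq [seq x <- q | x < m] (iota 0 m), [seq x <- q | m <= x] = s
    & avoid1342 q].

Definition starts_below (m : nat) (q : seq nat) : bool :=
  if q is a :: _ then a < m else false.

Lemma iota0S m : iota 0 m.+1 = rcons (iota 0 m) m.
Proof. by rewrite -addn1 iotaD add0n cats1. Qed.

(** The letters after [x] that exceed it are all pending, hence avoid 231, and [x] cannot be the 1
    of a 1342. No record of the letters already read is needed. *)
Lemma walk_spec_high m x s q : m <= x -> avoid231 (x :: s) ->
  walk_spec m (x :: s) (x :: q) <-> walk_spec m s q.
Proof.
move=> mx H; rewrite /walk_spec /= ltnNge mx /=; split=> -[H1 H2 H3].
  by case: H2 => H2; split=> //; apply: avoid1342_cons H3.
split=> //; first by rewrite H2.
apply: avoid1342_consE => //; apply: sub_avoid231 (avoid231_cons H).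
rewrite -H2 (_ : [seq y <- q | x < y] = [seq y <- [seq y <- q | m <= y] | x < y]).
  exact: filter_subseq.
rewrite -filter_predI; apply: eq_filter => y /=; lia.
Qed.

Lemma walk_spec_min m s q : all (fun x => m < x) s -> avoid231 s ->
  walk_spec m.+1 s (m :: q) <-> walk_spec m s q.
Proof.
move=> ms H; rewrite /walk_spec iota0S /= ltnSn ltnn.
rewrite (perm_sym _ (rcons _ _)) perm_rcons perm_cons perm_sym.
have fE : m \notin q -> [seq x <- q | x < m.+1] = [seq x <- q | x < m] /\
    [seq x <- q | m < x] = [seq x <- q | m <= x].
  by move=> mq; split; apply: eq_in_filter => x xq;
    have : x != m by [apply: contraNneq mq => <-|]; lia.
split=> -[H1 H2 H3].
  have [E1 E2] : [seq x <- q | x < m.+1] = [seq x <- q | x < m] /\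
      [seq x <- q | m < x] = [seq x <- q | m <= x].
    apply: fE; apply/negP => mq.
    have : m \in iota 0 m by rewrite -(perm_mem H1) mem_filter ltnSn.
    by rewrite mem_iota ltnn.
  by rewrite -E1 -E2; split=> //; apply: avoid1342_cons H3.
have [E1 E2] : [seq x <- q | x < m.+1] = [seq x <- q | x < m] /\
    [seq x <- q | m < x] = [seq x <- q | m <= x].
  apply: fE; apply/negP => mq.
  have : m \in s by rewrite -H2 mem_filter leqnn.
  by move/(allP ms); rewrite ltnn.
by rewrite E1 E2; split=> //; apply: avoid1342_consE => //; rewrite E2 H2.
Qed.

Lemma ins_index m h : uniq h -> m \in h ->
  ins (index m h) m [seq x <- h | x != m] = h.
Proof.
elim: h => // x h IH /= /andP[xh uh]; rewrite inE eq_sym.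
case: (eqVneq x m) xh => [-> mh _|xm _ /= mh] /=.
  rewrite ins0; congr cons; apply/all_filterP/allP => y yh.
  by apply: contraNneq mh => <-.
by rewrite insS IH.
Qed.

Lemma filter_gt_ins j m s : all (fun x => m < x) s ->
  [seq x <- ins j m s | m < x] = s.
Proof.
move=> ms; rewrite /ins filter_cat /= ltnn.
by rewrite -filter_cat cat_take_drop; apply/all_filterP.
Qed.

(** A first letter below [m] is the 1 of a 1342 over any 231 among the later letters from [m] on.
    These therefore avoid 231, which confines the place of [m] among the pending values to the first
    run. *)
Lemma walk_spec_ins m s q : all (fun x => m < x) s -> uniq s ->
  walk_spec m.+1 s q /\ starts_below m q <->
  exists2 j, j <= head 0 (runs s) & walk_spec m (ins j m s) q /\ starts_below m q.
Proof.
move=> ms us; split.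
  case: q => [|a q] [[H1 H2 H3]] //= am.
  set h := [seq x <- a :: q | m <= x].
  have hs : [seq x <- h | x != m] = s.
    by rewrite -H2 -filter_predI; apply: eq_filter => x /=; lia.
  have mh : m \in h.
    rewrite mem_filter leqnn /=.
    have : m \in iota 0 m.+1 by rewrite mem_iota /=; lia.
    by rewrite -(perm_mem H1) mem_filter => /andP[].
  have uh : uniq h.
    rewrite (perm_uniq (s2 := m :: s)) /=.
      by rewrite us andbT; apply/negP => /(allP ms); rewrite ltnn.
    rewrite -(perm_filterC (pred1 m) h).
    rewrite [X in _ ++ X]hs.
    have -> : [seq x <- h | pred1 m x] = [:: m].
      have : [seq x <- [seq x <- a :: q | x < m.+1] | m <= x] = [seq x <- h | pred1 m x].
        by rewrite -!filter_predI; apply: eq_filter => x /=; lia.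
      move=> <-; apply: perm_small_eq => //.
      apply: (perm_trans (perm_filter _ H1)).
      rewrite iota0S filter_rcons leqnn perm_rcons.
      rewrite (_ : [seq x <- iota 0 m | m <= x] = [::]) //.
      by apply/eqP; rewrite -[_ == _]negbK -has_filter; apply/hasPn => x; rewrite mem_iota /=; lia.
    exact: perm_refl.
  have hE := ins_index uh mh; rewrite hs in hE.
  have h231 : avoid231 h.
    have -> : h = [seq x <- q | m <= x] by rewrite /h /= leqNgt am.
    move=> b c d; rewrite subseq_filter => /andP[/= /and4P[mb mc md _] sub].
    have : subseq [:: a; b; c; d] (a :: q) by rewrite /= eqxx.
    by move/H3; rewrite (leq_trans am md).
  exists (index m h).
    apply: (avoid231_ins us ms); last by rewrite hE.
    have := index_mem m h; rewrite mh -[X in size X]hE /ins size_cat /= size_take size_drop.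
    by case: (ltnP (index m h) (size s)); lia.
  split=> //; split=> //.
  have := perm_filter (fun x => x < m) H1.
  rewrite -filter_predI iota0S filter_rcons ltnn.
  rewrite (_ : [seq x <- iota 0 m | x < m] = iota 0 m).
    by apply: perm_trans; rewrite (eq_filter (a2 := fun x => x < m)) // => x /=; lia.
  by apply/all_filterP/allP => x; rewrite mem_iota.
case=> j lej [[H1 H2 H3] st]; split=> //; split=> //; last first.
  rewrite -(filter_gt_ins j ms) -H2 -filter_predI; apply: eq_filter => x /=; lia.
rewrite -(perm_filterC (fun x => x < m) [seq x <- q | x < m.+1]).
rewrite iota0S -cats1; apply: perm_cat.
  rewrite -filter_predI; apply: perm_trans H1.
  by rewrite (eq_filter (a2 := fun x => x < m)) // => x /=; lia.
rewrite -filter_predI.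
rewrite (_ : [seq x <- q | _] = [seq x <- [seq x <- q | m <= x] | x < m.+1]).
  rewrite H2 /ins filter_cat /= ltnSn.
  have E t : {subset t <= s} -> [seq x <- t | x < m.+1] = [::].
    move=> ts; apply/eqP; rewrite -[_ == _]negbK -has_filter; apply/hasPn => x /ts /(allP ms) /=; lia.
  by rewrite !E // => x; [apply: mem_drop|apply: mem_take].
by rewrite -filter_predI; apply: eq_filter => x /=; lia.
Qed.

Lemma ins_all j m s : all (fun x => m < x) s -> all (leq m) (ins j m s).
Proof.
move=> ms; rewrite all_cat /= leqnn andTb -all_cat cat_take_drop.
by apply: sub_all ms => x /ltnW.
Qed.

Lemma ins_uniq j m s : all (fun x => m < x) s -> uniq s -> uniq (ins j m s).
Proof.
move=> ms us; rewrite (perm_uniq (s2 := m :: s)) /=.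
  by rewrite us andbT; apply/negP => /(allP ms); rewrite ltnn.
by rewrite /ins perm_catC /= perm_cons perm_catC cat_take_drop.
Qed.

Lemma mem_completions_rec m s q : all (leq m) s -> uniq s -> avoid231 s ->
  (forall s', all (leq m) s' -> uniq s' -> avoid231 s' -> forall q',
     q' \in low_completions m s' <-> walk_spec m s' q' /\ starts_below m q') ->
  q \in completions m s <-> walk_spec m s q.
Proof.
move=> ms us av low; elim: s q ms us av => [|x s IH] q ms us av.
  rewrite completions_nil mem_cat; split.
    case/orP => [|/(low _ ms us av)[]//].
    by rewrite mem_nseq => /andP[]; case: m {low ms} => // _ /eqP ->; split.
  case: q => [|a q] H.
    case: H => /perm_size; rewrite size_iota => <- _ _.
    by rewrite mem_head.
  apply/orP; right; apply/(low _ ms us av); split=> //.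
  case: H => _ /= H _; rewrite ltnNge; apply/negP => ma; move: H; rewrite ma; discriminate.
have /= /andP[mx ms'] := ms; have /= /andP[xs us'] := us.
have av' := avoid231_cons av.
rewrite completions_cons mem_cat; split.
  case/orP => [/mapP[q' /(IH _ ms' us' av') H ->]|/(low _ ms us av)[]//].
  exact/walk_spec_high.
case: q => [|a q] H; first by case: H.
have [am|ma] := ltnP a m.
  by apply/orP; right; apply/(low _ ms us av).
have ax : a = x by case: H => _ /=; rewrite ma => -[].
subst a; apply/orP; left; apply/mapP; exists q => //.
apply/(IH _ ms' us' av'); exact/(walk_spec_high _ mx av).
Qed.

Lemma mem_low_completions m s q : all (leq m) s -> uniq s -> avoid231 s ->
  q \in low_completions m s <-> walk_spec m s q /\ starts_below m q.
Proof.
elim: m s q => [|m IH] s q ms us av.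
  by split=> // -[_]; case: q.
have IHf q' : q' \in completions m s <-> walk_spec m s q'.
  apply: mem_completions_rec => //; first by apply: sub_all ms => x /ltnW.
  by move=> *; apply: IH.
rewrite low_completionsS mem_cat; split.
  case/orP => [/mapP[q' H ->]|/flatten_mapP[j jI H]].
    split; last exact: ltnSn.
    by apply/walk_spec_min => //; apply/IHf.
  move: jI; rewrite mem_iota add0n ltnS => /andP[_ lej].
  move: H => /(IH _ _ (ins_all j ms) (ins_uniq j ms us) (ins_avoid231 ms lej av)) H.
  have [H1 H2] : walk_spec m.+1 s q /\ starts_below m q by apply/walk_spec_ins => //; exists j.
  by split=> //; case: q {H H1} H2 => //= a q /ltnW.
case: q => [|a q] [H] //; rewrite [starts_below _ _]ltnS leq_eqVlt => /orP[/eqP am|am].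
  apply/orP; left; subst a; apply/mapP; exists q => //.
  by apply/IHf; apply/walk_spec_min.
apply/orP; right; apply/flatten_mapP.
have [j lej H'] : exists2 j, j <= head 0 (runs s) &
    walk_spec m (ins j m s) (a :: q) /\ starts_below m (a :: q).
  by apply/walk_spec_ins.
exists j; first by rewrite mem_iota add0n ltnS.
by apply/(IH _ _ (ins_all j ms) (ins_uniq j ms us) (ins_avoid231 ms lej av)).
Qed.

Lemma mem_completions m s q : all (leq m) s -> uniq s -> avoid231 s ->
  q \in completions m s <-> walk_spec m s q.
Proof. by move=> ms us av; apply: mem_completions_rec => // *; apply: mem_low_completions. Qed.

(** Together with [completions_uniq] this makes S_n(1342) the length of [completions n [::]]. *)
Lemma mem_completions_nil n q :
  q \in completions n [::] <-> perm_eq q (iota 0 n) /\ avoid1342 q.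
Proof.
rewrite mem_completions //; rewrite /walk_spec; split.
  case=> H1 H2 H3; split=> //.
  suff -> : q = [seq x <- q | x < n] by [].
  apply/esym/all_filterP/allP => x xq; rewrite ltnNge; apply/negP => nx.
  have : x \in [seq x <- q | n <= x] by rewrite mem_filter nx.
  by rewrite H2.
case=> H1 H2; have lt x : x \in q -> x < n by rewrite (perm_mem H1) mem_iota.
split=> //.
  by rewrite (_ : [seq x <- q | x < n] = q) //; apply/all_filterP/allP.
apply/eqP; rewrite -[_ == _]negbK -has_filter; apply/hasPn => x /lt; lia.
Qed.

Lemma uniq_flatten (T S : eqType) (f : T -> seq S) (r : seq T) : uniq r ->
  {in r, forall i, uniq (f i)} ->
  {in r &, forall i j x, x \in f i -> x \in f j -> i = j} ->
  uniq (flatten [seq f i | i <- r]).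
Proof.
elim: r => //= i r IH /andP[ir ur] uf disj.
rewrite cat_uniq uf ?mem_head //= IH //; last 2 first.
- by move=> j jr; apply: uf; rewrite inE jr orbT.
- by move=> j k jr kr; apply: disj; rewrite inE ?jr ?kr orbT.
rewrite andbT; apply/hasPn => x /flatten_mapP[j jr xj]; apply/negP => xi.
have E : i = j by apply: disj xi xj; rewrite inE ?eqxx ?jr ?orbT.
by rewrite E jr in ir.
Qed.

Lemma completions_rec_uniq m s : all (leq m) s -> uniq s -> avoid231 s ->
  (forall s', all (leq m) s' -> uniq s' -> avoid231 s' -> uniq (low_completions m s')) ->
  uniq (completions m s).
Proof.
move=> ms us av low; elim: s ms us av => [|x s IH] ms us av.
  rewrite completions_nil cat_uniq low //= andbT.
  case: m {ms low} => [|m]; first by [].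
  by rewrite -all_predC; apply/allP => x _.
have /= /andP[mx ms'] := ms; have /= /andP[xs us'] := us.
rewrite completions_cons cat_uniq low // map_inj_uniq; last by move=> ? ? [].
rewrite (IH ms' us' (avoid231_cons av)) andbT /=.
apply/hasPn => q /(mem_low_completions _ ms us av) [_ st]; apply/negP => /mapP[q' _ E].
by move: st; rewrite E /= ltnNge mx.
Qed.

(** A completion starting with the new minimum differs from the others in its first letter; among
    the others, the place where [m] was inserted is its index in the word of letters from [m] on. *)
Lemma low_completions_uniq m s : all (leq m) s -> uniq s -> avoid231 s -> uniq (low_completions m s).
Proof.
elim: m s => [|m IH] s ms us av //.
rewrite low_completionsS cat_uniq map_inj_uniq; last by move=> ? ? [].
rewrite completions_rec_uniq ?andTb //; last by apply: sub_all ms => x /ltnW.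
apply/andP; split.
  apply/hasPn => q /flatten_mapP[j jI qj]; apply/negP => /mapP[q' _ E].
  move: jI qj; rewrite mem_iota add0n ltnS => /andP[_ lej].
  move/(mem_low_completions _ (ins_all j ms) (ins_uniq j ms us) (ins_avoid231 ms lej av)).
  by case=> _; rewrite E /= ltnn.
apply: uniq_flatten; first exact: iota_uniq.
  move=> j; rewrite mem_iota add0n ltnS => /andP[_ lej].
  exact: IH (ins_all j ms) (ins_uniq j ms us) (ins_avoid231 ms lej av).
have ms' : m \notin s by apply/negP => /(allP ms); rewrite ltnn.
have insI j : j <= head 0 (runs s) -> index m (ins j m s) = j.
  move=> lej; rewrite /ins index_cat /= eqxx addn0.
  case: ifP => [/mem_take|_]; first by rewrite (negPf ms').
  by rewrite size_takel // (leq_trans lej) //; exact: head_runs_le.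
move=> j k; rewrite !mem_iota !add0n !ltnS => /andP[_ lej] /andP[_ lek] q.
move/(mem_low_completions _ (ins_all j ms) (ins_uniq j ms us) (ins_avoid231 ms lej av)).
case=> [[_ Ej _] _].
move/(mem_low_completions _ (ins_all k ms) (ins_uniq k ms us) (ins_avoid231 ms lek av)).
case=> [[_ Ek _] _].
by rewrite -(insI j) // -Ej Ek insI.
Qed.

Lemma completions_uniq m s : all (leq m) s -> uniq s -> avoid231 s -> uniq (completions m s).
Proof. by move=> ms us av; apply: completions_rec_uniq => // *; apply: low_completions_uniq. Qed.

Lemma subseq_map (T1 T2 : eqType) (f : T1 -> T2) (s : seq T2) (l : seq T1) :
  subseq s [seq f x | x <- l] -> exists2 l', subseq l' l & s = [seq f x | x <- l'].
Proof.
case/subseqP => m sm ->; exists (mask m l); first exact: mask_subseq.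
by rewrite map_mask.
Qed.

(** * Counting completions through run lengths *)

Definition split_run (j : nat) (ts : seq nat) : seq nat :=
  j.+1 :: (if head 0 ts - j == 0 then behead ts
           else (head 0 ts - j) :: behead ts).

(* The numbers of completions depend only on the lengths of the decreasing runs
   of the pending values. *)
Fixpoint run_count_rec (e : nat) (low : seq nat -> nat) (ts : seq nat) : nat :=
  if ts is t :: ts' then \sum_(i < t) low (i.+1 :: ts') + run_count_rec e low ts'
  else e + low [::].

Fixpoint low_run_count (m : nat) (ts : seq nat) : nat :=
  if m is m'.+1 then
    run_count_rec (m' == 0) (low_run_count m') ts +
    \sum_(j < (head 0 ts).+1) low_run_count m' (split_run j ts)
  else 0.

Definition run_count (m : nat) : seq nat -> nat := run_count_rec (m == 0) (low_run_count m).

Lemma low_run_countS m ts : low_run_count m.+1 ts =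
  run_count m ts + \sum_(j < (head 0 ts).+1) low_run_count m (split_run j ts).
Proof. by []. Qed.

Lemma run_count_cons m t ts :
  run_count m (t :: ts) = \sum_(i < t) low_run_count m (i.+1 :: ts) + run_count m ts.
Proof. by []. Qed.

Lemma run_count_runs_cons m x s :
  run_count m (runs (x :: s)) = run_count m (runs s) + low_run_count m (runs (x :: s)).
Proof.
case: s => [|y s]; first by rewrite runs_seq1 run_count_cons big_ord1 addnC.
rewrite runs_cons2 runs_cons_neq0 /=; case: ifP => _.
  by rewrite !run_count_cons big_ord_recr /= addnAC.
by rewrite run_count_cons big_ord1 addnC.
Qed.

Lemma size_completions_rec m s :
  (forall s', subseq s' s -> size (low_completions m s') = low_run_count m (runs s')) ->
  size (completions m s) = run_count m (runs s).
Proof.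
elim: s => [|x s IH] low.
  by rewrite completions_nil size_cat size_nseq low.
rewrite completions_cons size_cat size_map low // run_count_runs_cons IH // => s' ss.
exact: low (subseq_trans ss (subseq_cons _ _)).
Qed.

Lemma size_low_completions m s : all (leq m) s -> size (low_completions m s) = low_run_count m (runs s).
Proof.
elim: m s => [|m IH] s ms //.
rewrite low_completionsS size_cat size_map low_run_countS size_completions_rec; last first.
  move=> s' ss; apply: IH; apply/allP => x /(mem_subseq ss) /(allP ms); exact: ltnW.
congr addn; rewrite size_flatten /shape -map_comp sumnE big_map.
rewrite -[X in iota 0 X]subn0 -/(index_iota 0 _) big_mkord; apply: eq_bigr => j _ /=.
by rewrite IH ?ins_all // runs_ins //; have := ltn_ord j; rewrite ltnS.
Qed.

Lemma size_completions m : size (completions m [::]) = run_count m [::].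
Proof. by apply: size_completions_rec => s' /eqP ->; rewrite size_low_completions. Qed.

(** * The upper bound: left-to-right minima *)

Definition perm_avoid12453 (n : nat) (p : 'S_n) : Prop := forall a b c d e : 'I_n,
  a < b -> b < c -> c < d -> d < e ->
  ~~ [&& p a < p b, p b < p e, p e < p c & p c < p d].

Lemma sorted_enum_ord n (P : {set 'I_n}) : path.sorted ltn [seq val i | i <- enum P].
Proof.
apply: (subseq_sorted ltn_trans) (iota_ltn_sorted 0 n).
by rewrite -val_enum_ord; apply: map_subseq; rewrite enumT {1}/enum_mem; exact: filter_subseq.
Qed.

Section LRMinima.
Variable n : nat.
Implicit Types (p : 'S_n) (X : {set 'I_n}) (x y i : 'I_n).

Definition rank X (x : 'I_n) : nat := #|[set z in X | z < x]|.

Lemma rank_leq X x y : x <= y -> rank X x <= rank X y.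
Proof.
move=> xy; apply/subset_leq_card/fintype.subsetP => z; rewrite !inE => /andP[-> zx].
exact: leq_trans zx xy.
Qed.

Lemma rank_lt X x : x \in X -> rank X x < #|X|.
Proof.
move=> xX; apply/proper_card/properP; split.
  by apply/fintype.subsetP => z; rewrite inE => /andP[].
by exists x => //; rewrite inE ltnn andbF.
Qed.

Lemma rank_inj X : {in X &, injective (rank X)}.
Proof.
have H (x y : 'I_n) : x \in X -> x < y -> rank X x < rank X y.
  move=> xX xy; apply/proper_card/properP; split.
    by apply/fintype.subsetP => z; rewrite !inE => /andP[-> /ltn_trans]; apply.
  by exists x; rewrite !inE ?xX ?ltnn.
move=> x y xX yX E; case: (ltngtP x y) => [xy|yx|/val_inj //].
  by have := H _ _ xX xy; rewrite E ltnn.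
by have := H _ _ yX yx; rewrite E ltnn.
Qed.

Definition lrmin p : {set 'I_n} := [set i : 'I_n | [forall j : 'I_n, (j < i) ==> (p i < p j)]].

(** The standardization of the word that remains when the left-to-right minima are deleted. *)
Definition nonmin_word p : seq nat :=
  [seq rank (~: (p @: lrmin p)) (p i) | i <- enum (~: lrmin p)].

Lemma imset_lrmin_notin p i : i \notin lrmin p -> p i \in ~: (p @: lrmin p).
Proof. by move=> iA; rewrite inE (mem_imset _ _ perm_inj). Qed.

Lemma lrmin_lt p i (j : 'I_n) : i \in lrmin p -> j \in lrmin p -> (p j < p i) = (i < j).
Proof.
rewrite !inE => /forallP/(_ j) H1 /forallP/(_ i) H2.
case: (ltngtP i j) H1 H2 => [||/val_inj ->] /=; last by rewrite ltnn.
  by move=> _ _ H; rewrite H.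
by move=> _ H _; rewrite ltnNge ltnW.
Qed.

(** Left-to-right minima decrease, so each exceeds exactly those to its right. Hence the set of
    positions and the set of values determine which value stands where. *)
Lemma rank_lrmin p i : i \in lrmin p ->
  rank (p @: lrmin p) (p i) = #|[set j in lrmin p | i < j]|.
Proof.
move=> iA; rewrite /rank -[RHS](card_imset _ (@perm_inj _ p)); congr #|pred_of_set _|.
apply/finset.setP => z; rewrite inE; apply/andP/imsetP.
  case=> /imsetP[j jA ->] pji; exists j => //.
  by rewrite inE jA -(lrmin_lt iA jA).
by case=> j; rewrite inE => /andP[jA ij] ->; rewrite imset_f // lrmin_lt.
Qed.

Lemma lrmin_data_inj (p1 p2 : 'S_n) : lrmin p1 = lrmin p2 ->
  p1 @: lrmin p1 = p2 @: lrmin p2 -> nonmin_word p1 = nonmin_word p2 -> p1 = p2.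
Proof.
move=> eA eB eq; apply/permP => i.
have [iA|iA] := boolP (i \in lrmin p1).
  have iA2 : i \in lrmin p2 by rewrite -eA.
  apply: (@rank_inj (p1 @: lrmin p1)); rewrite ?imset_f //; first by rewrite eB imset_f.
  by rewrite rank_lrmin // eB rank_lrmin // eA.
have iA2 : i \notin lrmin p2 by rewrite -eA.
have := imset_lrmin_notin iA; have := imset_lrmin_notin iA2.
have iE : i \in enum (~: lrmin p1) by rewrite mem_enum finset.in_setC.
move: eq; rewrite /nonmin_word -eB -eA => /eq_in_map/(_ i iE) E H1 H2.
exact: rank_inj H2 H1 E.
Qed.

Lemma nonmin_word_completions p : perm_avoid12453 p ->
  nonmin_word p \in completions (n - #|lrmin p|) [::].
Proof.
move=> av; apply/mem_completions_nil; split.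
  have sz : size (nonmin_word p) = n - #|lrmin p|.
    by rewrite size_map -cardE -[X in _ = X - _](card_ord n) -(cardsC (lrmin p)) addKn.
  have un : uniq (nonmin_word p).
    rewrite map_inj_in_uniq ?enum_uniq // => i j.
    rewrite !mem_enum !finset.in_setC => /imset_lrmin_notin H1 /imset_lrmin_notin H2 E.
    exact: perm_inj (rank_inj H1 H2 E).
  apply: uniq_perm => //; first exact: iota_uniq.
  apply: (uniq_min_size un _ _).2; last by rewrite size_iota sz.
  move=> z /mapP[i]; rewrite mem_enum finset.in_setC => /imset_lrmin_notin H ->.
  rewrite mem_iota add0n /=; apply: leq_trans (rank_lt H) _.
  rewrite -[X in _ <= X - _](card_ord n) -(cardsC (p @: lrmin p)).
  by rewrite card_imset ?addKn //; exact: perm_inj.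
move=> a b c d /subseq_map[l' ls E]; apply/negP => /and3P[ad db bc].
case: l' E ls => [|i [|j [|k [|l [|? ?]]]]] // [Ea Eb Ec Ed] ls.
subst a b c d.
have st := sorted_enum_ord (~: lrmin p).
have := subseq_sorted ltn_trans (map_subseq val ls) st.
rewrite /= => /and4P[ij jk kl _].
have iA : i \notin lrmin p.
  have : i \in enum (~: lrmin p) by apply: (mem_subseq ls); rewrite mem_head.
  by rewrite mem_enum finset.in_setC.
(* The first letter of the 1342 is not a left-to-right minimum, so a smaller entry precedes it; this
   entry is the 1 of a 12453. *)
have [i0 i0i pi] : exists2 i0 : 'I_n, i0 < i & p i0 < p i.
  move: iA; rewrite inE negb_forall => /existsP[i0]; rewrite negb_imply => /andP[i0i].
  rewrite -leqNgt leq_eqVlt => /orP[/eqP/val_inj/perm_inj e|]; last by exists i0.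
  by rewrite e ltnn in i0i.
have lt (x y : 'I_n) : rank (~: (p @: lrmin p)) x < rank (~: (p @: lrmin p)) y -> x < y.
  by apply: contraTT; rewrite -!leqNgt; exact: rank_leq.
by have := av _ _ _ _ _ i0i ij jk kl; rewrite pi !lt.
Qed.

End LRMinima.

Lemma card_avoid12453_le n (S : {set 'S_n}) : (forall p, p \in S -> perm_avoid12453 p) ->
  #|S| <= \sum_(k < n.+1) 'C(n, k) ^ 2 * size (completions (n - k) [::]).
Proof.
move=> av.
have -> : #|S| = \sum_(k < n.+1) #|[set p in S | #|lrmin p| == k]|.
  rewrite -sum1_card (partition_big (fun p => inord #|lrmin p| : 'I_n.+1) xpredT) //=.
  apply: eq_bigr => k _; rewrite sum1_card; apply: eq_card => p; rewrite !inE.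
  congr (_ && _); rewrite -val_eqE /= inordK // ltnS.
  by rewrite -[X in _ <= X]card_ord max_card.
apply: leq_sum => k _.
pose draws := enum [set A : {set 'I_n} | #|A| == k].
have szd : size draws = 'C(n, k) by rewrite -cardE card_draws card_ord.
pose data (p : 'S_n) := (lrmin p, (p @: lrmin p, nonmin_word p)).
pose target := [seq (x, y) | x <- draws, y <- [seq (x', y') | x' <- draws, y' <- completions (n - k) [::]]].
have -> : 'C(n, k) ^ 2 * size (completions (n - k) [::]) = size target.
  by rewrite !size_allpairs szd expnS expn1 mulnA.
rewrite cardE -(size_map data); apply: uniq_leq_size.
  rewrite map_inj_uniq ?enum_uniq // => p1 p2 [].
  exact: lrmin_data_inj.
move=> z /mapP[p]; rewrite mem_enum inE => /andP[/av avp /eqP Ek] ->.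
apply/allpairsP; exists (lrmin p, (p @: lrmin p, nonmin_word p)) => /=.
rewrite mem_enum inE Ek eqxx; split=> //.
apply/allpairsP; exists (p @: lrmin p, nonmin_word p) => /=.
rewrite mem_enum inE card_imset ?Ek ?eqxx; last exact: perm_inj.
by split=> //; rewrite -Ek; exact: nonmin_word_completions.
Qed.

(** * The lower bound: weaving minima into a skew sum *)

Definition avoid12453 (s : seq nat) : Prop := forall a b c d e : nat,
  subseq [:: a; b; c; d; e] s -> ~~ [&& a < b, b < e, e < c & c < d].

Lemma subseq_cat_split (T : eqType) (s l1 l2 : seq T) : subseq s (l1 ++ l2) ->
  exists s1 s2, [/\ s = s1 ++ s2, subseq s1 l1 & subseq s2 l2].
Proof.
case/subseqP => m; rewrite size_cat => sm ->.
exists (mask (take (size l1) m) l1), (mask (drop (size l1) m) l2).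
rewrite !mask_subseq -mask_cat ?cat_take_drop //.
by rewrite size_takel // sm leq_addr.
Qed.

Section Weave.
Implicit Types (ps : seq (nat * nat)) (E e : seq nat).

(* A list of pairs [(g, r)] stands for the word [D^g M R^r ...]: reading values
   downwards, [D] and [M] name the next value, and reading positions, [M] and
   [R] fill the next one.  An [M] fills its position with its own value, and
   these are the left-to-right minima; the [R]s are filled from [E]. *)
Fixpoint height ps : nat := if ps is (g, _) :: ps' then (g + height ps').+1 else 0.

Fixpoint down_values ps : seq nat :=
  if ps is (g, _) :: ps' then rev (iota (height ps').+1 g) ++ down_values ps' else [::].

Fixpoint min_values ps : seq nat :=
  if ps is (_, _) :: ps' then height ps' :: min_values ps' else [::].

Fixpoint weave ps E : seq nat :=
  if ps is (_, r) :: ps' then height ps' :: take r E ++ weave ps' (drop r E)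
  else [::].

(* Every entry taken from [E] belongs to a [D] that occurred before it. *)
Fixpoint fits ps E : bool :=
  if ps is (_, r) :: ps' then
    all (fun x => height ps' < x) (take r E) && fits ps' (drop r E)
  else true.

Lemma perm_weave ps E : size E = sumn (unzip2 ps) ->
  perm_eq (weave ps E) (min_values ps ++ E).
Proof.
elim: ps E => [|[g r] ps IH] E /= sE; first by rewrite (size0nil sE).
rewrite perm_cons -{3}(cat_take_drop r E) perm_sym perm_catCA perm_sym perm_cat2l.
by apply: IH; rewrite size_drop sE addKn.
Qed.

Lemma perm_values ps :
  perm_eq (min_values ps ++ down_values ps) (iota 0 (height ps)).
Proof.
elim: ps => [|[g r] ps IH] //; apply/seq.permP => P.
have -> : iota 0 (height ((g, r) :: ps)) = rcons (iota 0 (height ps)) (height ps) ++ iota (height ps).+1 g.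
  by rewrite -iota0S -{2}[(height ps).+1]add0n -iotaD addSn addnC.
have := seq.permP IH P; rewrite -cats1 /= !count_cat /= count_rev; lia.
Qed.

Lemma height_min ps x : x \in min_values ps -> x < height ps.
Proof. by move=> xm; have := perm_mem (perm_values ps) x; rewrite mem_cat xm mem_iota. Qed.

Lemma height_down ps x : x \in down_values ps -> x < height ps.
Proof.
move=> xm; have := perm_mem (perm_values ps) x.
by rewrite mem_cat xm orbT mem_iota.
Qed.

Lemma down_values_sorted ps : path.sorted gtn (down_values ps).
Proof.
have gt_trans : transitive gtn by move=> x y z /=; lia.
rewrite (sorted_pairwise gt_trans); elim: ps => [|[g r] ps IH] //=.
rewrite pairwise_cat IH andbT; apply/andP; split.
  apply/allrelP => x y; rewrite mem_rev mem_iota => /andP[H _] /height_down /=; lia.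
rewrite -(sorted_pairwise gt_trans) rev_sorted.
exact: iota_ltn_sorted.
Qed.

Lemma size_down_values ps : size (down_values ps) = sumn (unzip1 ps).
Proof. by elim: ps => [|[g r] ps IH] //=; rewrite size_cat size_rev size_iota IH. Qed.

Lemma heightE ps : height ps = sumn (unzip1 ps) + size ps.
Proof. by elim: ps => [|[g r] ps IH] //=; rewrite IH; lia. Qed.

Lemma filter_weave (P : pred nat) ps E : size E = sumn (unzip2 ps) ->
  ~~ has P (min_values ps) -> all P E -> seq.filter P (weave ps E) = E.
Proof.
elim: ps E => [|[g r] ps IH] E /= sE; first by rewrite (size0nil sE).
rewrite negb_or => /andP[/negPf -> hP] aP; rewrite filter_cat IH //.
- by rewrite (_ : seq.filter P (take r E) = take r E) ?cat_take_drop //;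
    apply/all_filterP/allP => x /mem_take /(allP aP).
- by rewrite size_drop sE addKn.
- by apply/allP => x /mem_drop /(allP aP).
Qed.

(** Everything before an [M] is larger than it: earlier [M]s have larger values, and by [fits] an
    earlier entry of [E] exceeds the last [M] before it. *)
Lemma weave_min ps E x y : size E = sumn (unzip2 ps) -> fits ps E ->
  {in E, forall z, z \notin min_values ps} ->
  subseq [:: x; y] (weave ps E) -> x < y -> y \notin min_values ps.
Proof.
elim: ps E => [|[g r] ps IH] E //= sE /andP[fE1 fE2] disj sub xy.
have sE' : size (drop r E) = sumn (unzip2 ps) by rewrite size_drop sE addKn.
have wE z : z \in weave ps (drop r E) -> z \in min_values ps \/ z \in drop r E.
  by rewrite (perm_mem (perm_weave _)) // mem_cat => /orP.
have in_blk z : z \in take r E -> height ps < z by move/(allP fE1).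
have in_rest z : z \in weave ps (drop r E) -> z \in height ps :: min_values ps -> z \in min_values ps.
  case/wE => // /mem_drop /disj /negPf; rewrite inE => -> //.
apply/negP => ymin.
have ysub z : z \in take r E -> z \notin height ps :: min_values ps by move/mem_take/disj.
move: sub; case: eqP => [xh|_].
  rewrite sub1seq mem_cat => /orP[/ysub|/in_rest]; rewrite ?ymin // => /(_ isT)/height_min.
  by lia.
case/subseq_cat_split => s1 [s2 []].
case: s1 => [|x' [|y' [|? ?]]] //=.
- move=> <- _ sub; apply/negP: (ymin).
  suff : y \notin min_values ps.
    have /in_rest /(_ ymin) -> // : y \in weave ps (drop r E).
    by apply: (mem_subseq sub); rewrite !inE eqxx orbT.
  apply: (IH _ sE' fE2 _ sub xy) => z /mem_drop /disj; rewrite inE negb_or => /andP[] //.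
- case=> <- <-; rewrite !sub1seq => /in_blk xh /in_rest /(_ ymin) /height_min; lia.
- case=> _ <- _ sub _; have /ysub : y \in take r E by apply: (mem_subseq sub); rewrite !inE eqxx orbT.
  by rewrite ymin.
Qed.

Lemma down_notin_min ps x : x \in down_values ps -> x \notin min_values ps.
Proof.
have : uniq (min_values ps ++ down_values ps) by rewrite (perm_uniq (perm_values ps)) iota_uniq.
by rewrite cat_uniq => /and3P[_ /hasPn H _] /H.
Qed.

Lemma weave_avoid ps E : size E = sumn (unzip2 ps) -> fits ps E ->
  {subset E <= down_values ps} -> avoid1342 E -> avoid12453 (weave ps E).
Proof.
move=> sE fE ED av a b c d e sub; apply/negP => /and4P[ab be ec cd].
have disj : {in E, forall z, z \notin min_values ps} by move=> z /ED /down_notin_min.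
have nomin y : a < y -> subseq [:: a; y] (weave ps E) -> y \notin min_values ps.
  by move=> ay /(weave_min sE fE disj); apply.
have EE : [seq x <- weave ps E | x \notin min_values ps] = E.
  by apply: filter_weave => //; [apply/hasPn => x ->|apply/allP].
have : subseq [:: b; c; d; e] E.
  rewrite -EE subseq_filter (subseq_trans (subseq_cons _ a) sub) andbT /=.
  have t y : y \in [:: b; c; d; e] -> subseq [:: a; y] (weave ps E).
    move=> H; apply: subseq_trans sub.
    by rewrite -[[:: a; y]]cat1s -[[:: a, b & _]]cat1s subseq_cat2l sub1seq.
  by rewrite !nomin ?t ?inE ?eqxx ?orbT //; lia.
by move/av; rewrite be ec cd.
Qed.

(** The word is decoded from the left. Its first letter is the height of the rest, which yields [g];
    the next letter not above it is the next [M], and [r] is the number of letters in between. *)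
Lemma weave_inj ps1 ps2 E1 E2 : height ps1 = height ps2 ->
  size E1 = sumn (unzip2 ps1) -> size E2 = sumn (unzip2 ps2) ->
  fits ps1 E1 -> fits ps2 E2 -> weave ps1 E1 = weave ps2 E2 -> ps1 = ps2 /\ E1 = E2.
Proof.
elim: ps1 ps2 E1 E2 => [|[g1 r1] ps1 IH] [|[g2 r2] ps2] E1 E2 //=.
  by move=> _ /size0nil -> /size0nil ->.
move=> [eh] s1 s2 /andP[f1 f1'] /andP[f2 f2'] [eh' ew].
have eg : g1 = g2 by move: eh; rewrite eh'; lia.
have ft r ps E : size E = r + sumn (unzip2 ps) -> all (fun x => height ps < x) (take r E) ->
   find (fun x => x <= height ps) (take r E ++ weave ps (drop r E)) = r.
  move=> sE fE; rewrite find_cat ifF; last first.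
    by apply/negP => /hasP[x /(allP fE)]; rewrite ltnNge => /negPf ->.
  rewrite size_takel ?sE ?leq_addr // (_ : find _ _ = 0) ?addn0 //.
  by case: ps sE fE => [|[g r'] ps] //= _ _; rewrite ifT //; lia.
have er : r1 = r2.
  by rewrite -(ft r1 ps1 E1) // -[RHS](ft r2 ps2 E2) // ew eh'.
subst g2 r2.
have r1E1 : r1 <= size E1 by rewrite s1 leq_addr.
have r1E2 : r1 <= size E2 by rewrite s2 leq_addr.
have /eqP := ew; rewrite eqseq_cat; last by rewrite !size_takel.
move=> /andP[/eqP e1 /eqP e2].
have [-> e3] : ps1 = ps2 /\ drop r1 E1 = drop r1 E2.
  by apply: IH => //; rewrite size_drop ?s1 ?s2 addKn.
by split=> //; rewrite -(cat_take_drop r1 E1) e1 e3 cat_take_drop.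
Qed.

(** Here [pre] holds the values of the [D]s and [off] counts the [R]s of a part of the path already
    read. If each [R] uses a [D] numbered less than [t] beyond its own number, it suffices that at
    the end of every block the [D]s are [t] ahead of the [R]s, or all read. *)
Lemma fits_nth t ps pre e off :
  let dv := pre ++ down_values ps in
  all (fun x => height ps < x) pre ->
  (forall i, i < size e -> nth 0 e i < minn (size dv) (off + i + t)) ->
  size e = sumn (unzip2 ps) ->
  (forall j, j < size ps -> minn (size dv) (off + sumn (unzip2 (take j.+1 ps)) + t) <=
     size pre + sumn (unzip1 (take j.+1 ps))) ->
  fits ps [seq nth 0 dv x | x <- e].
Proof.
elim: ps pre e off => [|[g r] ps IH] pre e off dv //= hpre he se hj.
have hblk x : x \in pre ++ rev (iota (height ps).+1 g) -> height ps < x.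
  rewrite mem_cat mem_rev mem_iota => /orP[/(allP hpre)|/andP[]//]; lia.
have dvE : dv = (pre ++ rev (iota (height ps).+1 g)) ++ down_values ps by rewrite -catA.
have sb : size (pre ++ rev (iota (height ps).+1 g)) = size pre + g.
  by rewrite size_cat size_rev size_iota.
apply/andP; split.
  rewrite -map_take all_map; apply/allP => x /(nthP 0)[i]; rewrite size_take => ir <-.
  have ir' : i < r by move: ir; case: (ltnP r (size e)) => // h1 h2; exact: leq_trans h2 h1.
  have ie : i < size e by rewrite se; lia.
  rewrite /= nth_take // dvE nth_cat sb.
  have h1 := he i ie; have := hj 0 isT; rewrite /= take0 /= !addn0 => h2.
  have h3 : nth 0 e i < size pre + g by apply: leq_trans h2; move: h1; rewrite !leq_min => /andP[-> h1] /=; clear -h1 ir'; lia.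
  by rewrite h3; apply: hblk; apply: mem_nth; rewrite sb.
rewrite -map_drop dvE; apply: (IH _ _ (off + r)).
- by apply/allP => x; exact: hblk.
- move=> i; rewrite size_drop => ir; rewrite nth_drop -dvE.
  have := he (r + i); rewrite addnA; apply; lia.
- by rewrite size_drop se addKn.
move=> j jps; rewrite -dvE sb.
by have := hj j.+1 jps; rewrite /= !addnA.
Qed.

End Weave.

(** The letters number the [D]s, which run through the values downwards. Each block is therefore
    complemented, and a direct sum of numbers is a skew sum of values. *)
Fixpoint skew (t c : nat) (qs : seq (seq nat)) : seq nat :=
  if qs is q :: qs' then [seq c + (t.-1 - x) | x <- q] ++ skew t (c + t) qs' else [::].

Section Skew.
Variable t : nat.
Implicit Types (c : nat) (qs : seq (seq nat)).

Lemma size_avoider q : q \in completions t [::] -> size q = t.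
Proof. by case/mem_completions_nil => /perm_size; rewrite size_iota. Qed.

Lemma avoider_lt q x : q \in completions t [::] -> x \in q -> x < t.
Proof. by case/mem_completions_nil => /perm_mem -> _; rewrite mem_iota. Qed.

Lemma size_skew c qs : all (mem (completions t [::])) qs -> size (skew t c qs) = size qs * t.
Proof.
elim: qs c => [|q qs IH] c //= /andP[qt qst].
by rewrite size_cat size_map IH // (size_avoider qt).
Qed.

Lemma skew_mem c qs x : all (mem (completions t [::])) qs -> x \in skew t c qs ->
  c <= x < c + size qs * t.
Proof.
elim: qs c => [|q qs IH] c //= /andP[qt qst]; rewrite mem_cat.
case/orP => [/mapP[y /(avoider_lt qt) yt ->]|/(IH _ qst)]; lia.
Qed.

Lemma perm_skew c qs : all (mem (completions t [::])) qs ->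
  perm_eq (skew t c qs) (iota c (size qs * t)).
Proof.
elim: qs c => [|q qs IH] c //= /andP[qt qst].
rewrite iotaD; apply: perm_cat; last exact: IH.
have [qp _] := (mem_completions_nil t q).1 qt.
have un : uniq [seq c + (t.-1 - x) | x <- q].
  rewrite map_inj_in_uniq ?(perm_uniq qp) ?iota_uniq // => x y /(avoider_lt qt) xt /(avoider_lt qt) yt; lia.
apply: uniq_perm => //; first exact: iota_uniq.
apply: (uniq_min_size un _ _).2.
  by move=> x /mapP[y /(avoider_lt qt) yt ->]; rewrite mem_iota; lia.
by rewrite size_iota size_map (size_avoider qt).
Qed.

(** An entry stays inside its block of [t] consecutive numbers; this is the distance [t] demanded of
    the staircase. *)
Lemma skew_nth c qs i : all (mem (completions t [::])) qs -> i < size qs * t ->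
  nth 0 (skew t c qs) i < c + i + t.
Proof.
elim: qs c i => [|q qs IH] c i //= /andP[qt qst] iq.
rewrite nth_cat size_map (size_avoider qt); case: (ltnP i t) => it.
  rewrite (nth_map 0) ?(size_avoider qt) //; lia.
have : i - t < size qs * t by lia.
move/(IH (c + t) _ qst); lia.
Qed.

(* Increasing D-numbers mean decreasing values, so the order is reversed. *)
Lemma skew_avoid qs a b k d : all (mem (completions t [::])) qs -> forall c,
  subseq [:: a; b; k; d] (skew t c qs) -> ~~ [&& d < a, b < d & k < b].
Proof.
elim: qs => [|q qs IH] //= /andP[qt qst] c.
have [_ av] := (mem_completions_nil t q).1 qt.
have lt1 x : x \in [seq c + (t.-1 - x) | x <- q] -> x < c + t.
  by case/mapP => y /(avoider_lt qt) yt ->; lia.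
have lt2 x : x \in skew t (c + t) qs -> c + t <= x by case/(skew_mem qst)/andP.
case/subseq_cat_split => s1 [s2 [e sub1 sub2]].
case: s1 e sub1 => [|x s1] /=; first by move=> e _; rewrite -e in sub2; exact: IH qst _ sub2.
case=> <- e sub1; apply/negP => /and3P[da bd kb].
have ac : a < c + t by apply: lt1; apply: (mem_subseq sub1); rewrite mem_head.
(* The pattern is skew-indecomposable: its last number is below its first, hence in the first block,
   and so is everything in between. *)
have s20 : s2 = [::].
  case: (lastP s2) sub2 e => // s z sub2 e.
  have zd : z = d by have := congr1 (last 0) e; rewrite /= last_cat last_rcons.
  have : c + t <= z by apply: lt2; apply: (mem_subseq sub2); rewrite mem_rcons mem_head.
  by rewrite zd; lia.
move: e sub1; rewrite s20 cats0 => <- /subseq_map[l].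
case: l => [|a' [|b' [|k' [|d' [|? ?]]]]] // sl [ea eb ek ed].
have lt z : z \in [:: a'; b'; k'; d'] -> z < t by move/(mem_subseq sl)/(avoider_lt qt).
have := av _ _ _ _ sl.
have := lt a'; have := lt b'; have := lt k'; have := lt d'.
rewrite !inE !eqxx !orbT => /(_ isT) h1 /(_ isT) h2 /(_ isT) h3 /(_ isT) h4.
by lia.
Qed.

Lemma skew_inj c qs1 qs2 : all (mem (completions t [::])) qs1 -> all (mem (completions t [::])) qs2 ->
  size qs1 = size qs2 -> skew t c qs1 = skew t c qs2 -> qs1 = qs2.
Proof.
elim: qs1 qs2 c => [|q1 qs1 IH] [|q2 qs2] c //= /andP[t1 ts1] /andP[t2 ts2] [es] /eqP.
rewrite eqseq_cat ?size_map ?(size_avoider t1) ?(size_avoider t2) // => /andP[/eqP e1 /eqP e2].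
rewrite (IH _ _ ts1 ts2 es e2); congr cons.
have : {in [pred x | x < t] &, injective (fun x => c + (t.-1 - x))} by move=> x y; rewrite !inE; lia.
move/inj_in_map; apply => //; by apply/allP => x; rewrite inE; apply: avoider_lt.
Qed.

Fixpoint avoider_lists b : seq (seq (seq nat)) :=
  if b is b'.+1 then [seq q :: qs | q <- completions t [::], qs <- avoider_lists b'] else [:: [::]].

Lemma size_avoider_lists b : size (avoider_lists b) = size (completions t [::]) ^ b.
Proof. by elim: b => //= b IH; rewrite size_allpairs IH expnS. Qed.

Lemma uniq_avoider_lists b : uniq (avoider_lists b).
Proof.
elim: b => //= b IH; apply: allpairs_uniq => //; first exact: completions_uniq.
by move=> [q qs] [q' qs'] _ _ /= [-> ->].
Qed.

Lemma avoider_listsP b qs : qs \in avoider_lists b ->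
  size qs = b /\ all (mem (completions t [::])) qs.
Proof.
elim: b qs => [|b IH] qs /=; first by rewrite inE => /eqP ->.
by case/allpairsP => -[q qs'] /= [qt /IH[<- h] ->]; rewrite /= h andbT.
Qed.

End Skew.

(** * Balanced lattice paths and their rotations *)

Section Dominated.
Implicit Types (ps : seq (nat * nat)).

Definition dominated ps : bool :=
  all (fun i => sumn (unzip2 (take i ps)) <= sumn (unzip1 (take i ps))) (iota 0 (size ps).+1).

Lemma dominatedP ps : dominated ps ->
  forall i, sumn (unzip2 (take i ps)) <= sumn (unzip1 (take i ps)).
Proof.
move=> /allP dom i; have [le|lt] := leqP i (size ps); first by apply: dom; rewrite mem_iota add0n ltnS.
have := dom (size ps); rewrite mem_iota add0n ltnSn => /(_ isT).
by rewrite !take_oversize // ltnW.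
Qed.

Lemma sumn_take_drop (f : nat * nat -> nat) i ps :
  sumn (map f (take i ps)) + sumn (map f (drop i ps)) = sumn (map f ps).
Proof. by rewrite -sumn_cat -map_cat cat_take_drop. Qed.

Lemma sumn_take_add (f : nat * nat -> nat) i j ps :
  sumn (map f (take (j + i) ps)) = sumn (map f (take j ps)) + sumn (map f (take i (drop j ps))).
Proof. by rewrite takeD map_cat sumn_cat. Qed.

(* Start the cyclic walk right after the minimum of its partial sums. *)
Lemma dominated_rot ps : ps != [::] -> sumn (unzip1 ps) = sumn (unzip2 ps) ->
  exists2 j, j < size ps & dominated (rot j ps).
Proof.
move=> ps0 tot.
pose s1 i := sumn (unzip1 (take i ps)); pose s2 i := sumn (unzip2 (take i ps)).
have s2le i : s2 i <= sumn (unzip2 ps) by rewrite -(sumn_take_drop snd i) leq_addr.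
have sz : 0 < size ps by rewrite lt0n size_eq0.
(* This minimizes [s1 - s2], shifted by the total so that it is a natural number. *)
case: (@arg_minnP _ (Ordinal sz) xpredT (fun i : 'I_(size ps) => s1 i + (sumn (unzip2 ps) - s2 i))) => // j _ jmin.
have {}jmin i : i <= size ps -> s1 j + s2 i <= s1 i + s2 j.
  rewrite leq_eqVlt => /orP[/eqP ->|ilt].
    have := jmin (Ordinal sz) isT; rewrite /= /s1 /s2 take0 /= take_size tot.
    have := s2le j; rewrite /s2 /s1; lia.
  have := jmin (Ordinal ilt) isT; have := s2le j; have := s2le i => /=; lia.
exists j => //; apply/allP => i; rewrite mem_iota add0n ltnS size_rot => /andP[_ ilt].
have jlt := ltn_ord j.
rewrite /rot take_cat size_drop; case: ltnP => ij.
  have := jmin (j + i); rewrite /s1 /s2 /unzip1 /unzip2 !sumn_take_add; lia.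
rewrite take_takel; last by lia.
rewrite /unzip1 /unzip2 !map_cat !sumn_cat.
have := jmin (i - (size ps - j)); rewrite /s1 /s2 /unzip1 /unzip2.
have := sumn_take_drop fst j ps; have := sumn_take_drop snd j ps.
by move: tot; rewrite /unzip1 /unzip2; lia.
Qed.

(** Weak compositions of [m] into [k.+1] parts, as bounded tuples so that [card_ord_partitions]
    counts them. *)
Definition compositions (k m : nat) : seq (seq nat) :=
  [seq [seq val i | i <- tval t] | t <- enum [set t : k.+1.-tuple 'I_m.+1 | \sum_(i <- t) i == m]].

Lemma size_compositions k m : size (compositions k m) = 'C(k + m, k).
Proof. by rewrite size_map -cardE card_ord_partitions. Qed.

Lemma uniq_compositions k m : uniq (compositions k m).
Proof.
rewrite map_inj_uniq ?enum_uniq // => t1 t2 /(inj_map val_inj); exact: val_inj.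
Qed.

Lemma compositionsP k m s :
  s \in compositions k m <-> size s = k.+1 /\ sumn s = m.
Proof.
split=> [/mapP[t]|[sz sm]].
  rewrite mem_enum inE => /eqP tm ->.
  by rewrite size_map size_tuple sumnE big_map.
have szt : size [seq inord i : 'I_m.+1 | i <- s] == k.+1 by rewrite size_map sz.
have e : [seq val i | i <- [seq inord i : 'I_m.+1 | i <- s]] = s.
  rewrite -map_comp -[RHS]map_id; apply/eq_in_map => x xs /=; rewrite inordK // ltnS -sm.
  by case/splitPr: xs => s1 s2; rewrite sumn_cat /=; lia.
apply/mapP; exists (Tuple szt); last by rewrite e.
by rewrite mem_enum inE /= -(big_map val xpredT id) e -sumnE sm.
Qed.

Definition closed_pairs (k m : nat) : seq (seq (nat * nat)) :=
  [seq zip gs rs | gs <- compositions k m, rs <- compositions k m].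

Lemma closed_pairsP k m ps : ps \in closed_pairs k m <->
  [/\ size ps = k.+1, sumn (unzip1 ps) = m & sumn (unzip2 ps) = m].
Proof.
split=> [/allpairsP[[gs rs] /= [/compositionsP[sg mg] /compositionsP[sr mr] ->]]|[sz m1 m2]].
  by rewrite size_zip unzip1_zip ?unzip2_zip ?sg ?sr ?minnn.
apply/allpairsP; exists (unzip1 ps, unzip2 ps) => /=; rewrite zip_unzip; split=> //.
  by apply/compositionsP; rewrite size_map.
by apply/compositionsP; rewrite size_map.
Qed.

Lemma uniq_closed_pairs k m : uniq (closed_pairs k m).
Proof.
apply: allpairs_uniq; try exact: uniq_compositions.
move=> x y /allpairsP[[g1 r1] /= [/compositionsP[sg1 _] /compositionsP[sr1 _] ->]].
move=> /allpairsP[[g2 r2] /= [/compositionsP[sg2 _] /compositionsP[sr2 _] ->]] /= e.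
by congr pair; [have := congr1 unzip1 e; rewrite !unzip1_zip ?sg1 ?sg2 ?sr1 ?sr2|
  have := congr1 unzip2 e; rewrite !unzip2_zip ?sg1 ?sg2 ?sr1 ?sr2].
Qed.

Lemma size_closed_pairs k m : size (closed_pairs k m) = 'C(k + m, k) ^ 2.
Proof. by rewrite size_allpairs size_compositions expnS expn1. Qed.

Lemma mem_closed_pairs_rot k m ps j : ps \in closed_pairs k m -> rot j ps \in closed_pairs k m.
Proof.
case/closed_pairsP => sz m1 m2; apply/closed_pairsP.
by rewrite size_rot /unzip1 /unzip2 !map_rot !sumn_rot.
Qed.

Definition dominated_pairs k m := [seq ps <- closed_pairs k m | dominated ps].

Lemma size_dominated_pairs k m : 'C(k + m, k) ^ 2 <= k.+1 * size (dominated_pairs k m).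
Proof.
rewrite -size_closed_pairs.
have -> : k.+1 * size (dominated_pairs k m) =
  size [seq rotr j ps | j <- iota 0 k.+1, ps <- dominated_pairs k m].
  by rewrite size_allpairs size_iota.
apply: uniq_leq_size; first exact: uniq_closed_pairs.
move=> ps psin; have /closed_pairsP[sz m1 m2] := psin.
have [||j jlt dom] := @dominated_rot ps; rewrite ?m1 ?m2 // -?size_eq0 ?sz //.
apply/allpairsP; exists (j, rot j ps); split; last by rewrite /= rotK.
  by rewrite mem_iota add0n -sz.
by rewrite mem_filter /= dom mem_closed_pairs_rot.
Qed.

End Dominated.

(** With [s] [D]s in front and [s] [R]s at the end, a dominated path becomes one whose [D]s stay [s]
    ahead. For [s = b * t - m] the lead is at least [t], and the number of [D]s becomes [b * t],
    which [b] blocks fill exactly. *)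
Definition extend (s : nat) (ps : seq (nat * nat)) := (s, 0) :: rcons ps (0, s).

Lemma extend_inj s : injective (extend s).
Proof. by move=> ps1 ps2 [] /rcons_inj[]. Qed.

Definition woven t s ps qs : seq nat :=
  weave (extend s ps) [seq nth 0 (down_values (extend s ps)) x | x <- skew t 0 qs].

Section Woven.
Variables t b k m : nat.
Hypothesis slack : m + t <= b * t.

Let s := b * t - m.

Section OneWord.
Variable ps : seq (nat * nat).
Hypothesis psP : ps \in dominated_pairs k m.

Let eps := extend s ps.
Let dv := down_values eps.

Lemma size_extend : size eps = k.+3.
Proof.
by move: psP; rewrite mem_filter => /andP[_ /closed_pairsP[sz _ _]]; rewrite /= size_rcons sz.
Qed.

Lemma sum_extend : sumn (unzip1 eps) = b * t /\ sumn (unzip2 eps) = b * t.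
Proof.
move: psP; rewrite mem_filter => /andP[_ /closed_pairsP[_ m1 m2]].
rewrite /unzip1 /unzip2 /= !map_rcons !sumn_rcons -/(unzip1 ps) -/(unzip2 ps) m1 m2 /s /=; lia.
Qed.

Lemma height_extend : height eps = b * t + k.+3.
Proof. by rewrite heightE size_extend sum_extend.1. Qed.

Lemma size_dv : size dv = b * t.
Proof. by rewrite size_down_values sum_extend.1. Qed.

Variable qs : seq (seq nat).
Hypothesis qsP : qs \in avoider_lists t b.
Let E := [seq nth 0 dv x | x <- skew t 0 qs].

Lemma size_woven_rest : size E = sumn (unzip2 eps).
Proof.
have [sq aq] := avoider_listsP qsP.
by rewrite size_map size_skew // sq sum_extend.2.
Qed.

Lemma perm_woven_rest : perm_eq E dv.
Proof.
have [sq aq] := avoider_listsP qsP.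
apply: perm_trans (perm_map _ (perm_skew 0 aq)) _.
by rewrite sq -size_dv map_nth_iota0 // take_size.
Qed.

Lemma fits_woven : fits eps E.
Proof.
have [sq aq] := avoider_listsP qsP.
apply: (@fits_nth t eps [::] _ 0) => //.
- move=> i; rewrite size_skew // sq => iq; rewrite cat0s -/dv size_dv leq_min.
  rewrite (skew_nth 0 aq) ?sq // andbT.
  have := @skew_mem t 0 qs (nth 0 (skew t 0 qs) i) aq.
  by rewrite mem_nth ?size_skew ?sq // => /(_ isT) /andP[_].
- by rewrite size_skew // sq sum_extend.2.
move=> j _; rewrite cat0s -/dv size_dv add0n /= !add0n.
move: psP; rewrite mem_filter => /andP[/dominatedP dom /closed_pairsP[sz m1 m2]].
(* Within [ps], dominance adds to the lead [s >= t]; from its end on, all [D]s have been read. *)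
rewrite geq_min -cats1 take_cat; case: (ltnP j (size ps)) => jp.
  by apply/orP; right; have := dom j; rewrite /s; lia.
apply/orP; left; rewrite /unzip1 /unzip2 !map_cat !sumn_cat -/(unzip1 ps) m1 /s; lia.
Qed.

Lemma avoid_woven_rest : avoid1342 E.
Proof.
have [sq aq] := avoider_listsP qsP.
move=> x1 x2 x3 x4 /subseq_map[l]; case: l => [|a [|c [|d [|e [|? ?]]]]] // sub [-> -> -> ->].
have lt x : x \in [:: a; c; d; e] -> x < size dv.
  by move/(mem_subseq sub)/(skew_mem aq)/andP => [_]; rewrite size_dv sq.
have gt_trans : transitive gtn by move=> x y z /=; lia.
have dec x y : x \in [:: a; c; d; e] -> y \in [:: a; c; d; e] -> nth 0 dv x < nth 0 dv y -> y < x.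
  move=> /lt xd /lt yd; case: (ltngtP y x) => // [xy|->]; last by rewrite ltnn.
  have := sorted_ltn_nth gt_trans 0 (down_values_sorted eps) x y xd yd xy.
  by rewrite /= => h1 /(ltn_trans h1); rewrite ltnn.
have := skew_avoid aq sub; apply: contraNN => /and3P[h1 h2 h3].
by apply/and3P; split; [apply: dec h1|apply: dec h2|apply: dec h3]; rewrite !inE eqxx ?orbT.
Qed.

Lemma woven_perm : perm_eq (woven t s ps qs) (iota 0 (b * t + k.+3)).
Proof.
rewrite -height_extend; apply: perm_trans (perm_values eps).
by apply: perm_trans (perm_weave size_woven_rest) _; rewrite perm_cat2l perm_woven_rest.
Qed.

Lemma woven_avoid : avoid12453 (woven t s ps qs).
Proof.
apply: weave_avoid size_woven_rest fits_woven _ avoid_woven_rest.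
by move=> x; rewrite (perm_mem perm_woven_rest).
Qed.

End OneWord.

Lemma woven_inj ps1 ps2 qs1 qs2 :
  ps1 \in dominated_pairs k m -> qs1 \in avoider_lists t b ->
  ps2 \in dominated_pairs k m -> qs2 \in avoider_lists t b ->
  woven t s ps1 qs1 = woven t s ps2 qs2 -> ps1 = ps2 /\ qs1 = qs2.
Proof.
move=> p1 q1 p2 q2 hw.
have eh : height (extend s ps1) = height (extend s ps2).
  by rewrite (height_extend p1) (height_extend p2).
have [/extend_inj e eE] := weave_inj eh (size_woven_rest p1 q1) (size_woven_rest p2 q2)
  (fits_woven p1 q1) (fits_woven p2 q2) hw.
have [sq1 aq1] := avoider_listsP q1; have [sq2 aq2] := avoider_listsP q2.
subst ps2; split=> //; apply: (@skew_inj t 0) => //; first by rewrite sq1 sq2.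
set dv := down_values _ in eE.
have sdv : size dv = b * t by apply: size_dv.
have udv : uniq dv.
  apply: (sorted_uniq (leT := gtn)) (down_values_sorted _); first by move=> x y z /=; lia.
  by move=> x /=; rewrite ltnn.
have : {in [pred x | x < size dv] &, injective (nth 0 dv)}.
  by move=> x y; rewrite !inE => xd yd /eqP; rewrite nth_uniq // => /eqP.
move/inj_in_map; apply=> //; apply/allP => x; rewrite inE sdv.
  by move/(skew_mem aq1)/andP => [_]; rewrite sq1.
by move/(skew_mem aq2)/andP => [_]; rewrite sq2.
Qed.

Lemma exists_avoiders : exists L : seq (seq nat),
  [/\ uniq L,
     {in L, forall w, perm_eq w (iota 0 (b * t + k.+3)) /\ avoid12453 w}
   & 'C(k + m, k) ^ 2 * size (completions t [::]) ^ b <= k.+1 * size L].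
Proof.
exists [seq woven t s ps qs | ps <- dominated_pairs k m, qs <- avoider_lists t b]; split.
- apply: allpairs_uniq; [exact: filter_uniq (uniq_closed_pairs _ _)|exact: uniq_avoider_lists|].
  move=> x y /allpairsP[[p1 q1] /= [h1 h2 ->]] /allpairsP[[p2 q2] /= [h3 h4 ->]] /=.
  by case/woven_inj => // -> ->.
- by move=> w /allpairsP[[p q] /= [h1 h2 ->]]; split; [exact: woven_perm|exact: woven_avoid].
by rewrite size_allpairs size_avoider_lists mulnA leq_mul2r size_dominated_pairs orbT.
Qed.

End Woven.

(** * From permutations to words *)

Lemma pat12453_val (i : 'I_5) : pat12453 i = nth 0 [:: 0; 1; 3; 4; 2] i :> nat.
Proof.
by rewrite permE /word12453 /=; case: i => [[|[|[|[|[|i]]]]] Hi] //=; rewrite inordK.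
Qed.

Lemma avoids_pat12453P n (p : 'S_n) : avoids p pat12453 <-> perm_avoid12453 p.
Proof.
split=> [/existsPn av a b c d e ab bc cd de|av].
  apply/negP => /and4P[pab pbe pec pcd].
  have /negP := av [ffun i : 'I_5 => nth a [:: a; b; c; d; e] i]; apply.
  apply/andP; split; apply/forallP => i; apply/forallP => j; rewrite !ffunE ?pat12453_val.
    case: i j => [[|[|[|[|[|i]]]]] Hi] [[|[|[|[|[|j]]]]] Hj] //=; lia.
  case: i j => [[|[|[|[|[|i]]]]] Hi] [[|[|[|[|[|j]]]]] Hj] //=; apply/eqP; lia.
apply/negP => /existsP[f /andP[/forallP pos /forallP val]].
pose o i (H : i < 5) : 'I_5 := Ordinal H.
have fpos (i j : 'I_5) : i < j -> f i < f j by have /forallP/(_ j)/implyP := pos i.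
have fval (i j : 'I_5) : (p (f i) < p (f j)) = (nth 0 [:: 0; 1; 3; 4; 2] i < nth 0 [:: 0; 1; 3; 4; 2] j).
  by have /forallP/(_ j)/eqP := val i; rewrite !pat12453_val.
have := av (f (@o 0 isT)) (f (@o 1 isT)) (f (@o 2 isT)) (f (@o 3 isT)) (f (@o 4 isT)).
by rewrite !fval !fpos // => /(_ isT isT isT isT).
Qed.

Lemma word_of_perm n (w : seq nat) : perm_eq w (iota 0 n) ->
  exists p : 'S_n, w = [seq val (p i) | i <- enum 'I_n].
Proof.
have -> : iota 0 n = [tuple val i | i < n] by rewrite -val_enum_ord.
case/tuple_permP => p ->; exists p => /=; apply: eq_map => i.
by rewrite tnth_mktuple.
Qed.

Lemma perm_avoid12453_word n (p : 'S_n) : perm_avoid12453 p <-> avoid12453 [seq val (p i) | i <- enum 'I_n].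
Proof.
split=> [av a b c d e /subseq_map[l]|av a b c d e ab bc cd de].
  case: l => [|i1 [|i2 [|i3 [|i4 [|i5 [|? ?]]]]]] // sub [-> -> -> -> ->].
  have := subseq_sorted ltn_trans (map_subseq val sub).
  rewrite val_enum_ord => /(_ (iota_ltn_sorted 0 n)) /= /and5P[h1 h2 h3 h4 _].
  exact: av.
apply: av; rewrite -[[:: _; _; _; _; _]]/(map (fun i => val (p i)) [:: a; b; c; d; e]).
apply: map_subseq.
have inj : injective (val : 'I_n -> nat) := val_inj.
rewrite (_ : [:: a; b; c; d; e] = [seq i <- enum 'I_n | i \in [:: a; b; c; d; e]]).
  exact: filter_subseq.
apply: (inj_map inj); apply: (irr_sorted_eq ltn_trans ltnn).
- by rewrite /= ab bc cd de.
- apply: (subseq_sorted ltn_trans) (map_subseq _ (filter_subseq _ _)) _.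
  by rewrite val_enum_ord iota_ltn_sorted.
move=> x; apply/mapP/mapP => -[i hi ->]; exists i => //.
  by rewrite mem_filter hi mem_enum.
by move: hi; rewrite mem_filter => /andP[].
Qed.

Lemma num_avoiding_ge n (L : seq (seq nat)) : uniq L ->
  {in L, forall w, perm_eq w (iota 0 n) /\ avoid12453 w} ->
  size L <= num_avoiding pat12453 n.
Proof.
move=> uL avL; rewrite /num_avoiding cardE.
rewrite -(size_map (fun p : 'S_n => [seq val (p i) | i <- enum 'I_n])).
apply: uniq_leq_size => // w wL; have [/word_of_perm[p e] av] := avL w wL.
apply/mapP; exists p => //; rewrite mem_enum inE; apply/avoids_pat12453P/perm_avoid12453_word.
by rewrite -e.
Qed.

(** A largest letter in front cannot be the 1 of the pattern. Monotonicity is needed because weaving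
    reaches only the lengths [b * t + k.+3]. *)
Lemma num_avoiding_leS n : num_avoiding pat12453 n <= num_avoiding pat12453 n.+1.
Proof.
pose L := [seq n :: [seq val (p i) | i <- enum 'I_n] | p : 'S_n <- enum [set p : 'S_n | avoids p pat12453]].
have <- : size L = num_avoiding pat12453 n by rewrite size_map -cardE.
apply: num_avoiding_ge.
  rewrite map_inj_uniq ?enum_uniq // => p1 p2 [] /eq_in_map e.
  by apply/permP => i; apply: val_inj; apply: e; rewrite mem_enum.
move=> w /mapP[p]; rewrite mem_enum inE => /avoids_pat12453P/perm_avoid12453_word av ->; split.
  rewrite iota0S perm_sym perm_rcons perm_cons perm_sym -val_enum_ord map_comp.
  apply: perm_map; apply: uniq_perm; rewrite ?enum_uniq //.
    by rewrite map_inj_uniq ?enum_uniq //; exact: perm_inj.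
  move=> i; rewrite mem_enum; apply/mapP; exists (p^-1 i)%g; first by rewrite mem_enum.
  by rewrite permKV.
move=> a b c d e; rewrite /=; case: eqP => [->|_]; last exact: av.
move=> sub; apply/negP => /andP[nb _].
have /mapP[i _ ei] : b \in [seq val (p i) | i <- enum 'I_n].
  by apply: (mem_subseq sub); rewrite mem_head.
by have := ltn_ord (p i); rewrite -[nat_of_ord _]ei; lia.
Qed.

Lemma num_avoiding_mono m n : m <= n -> num_avoiding pat12453 m <= num_avoiding pat12453 n.
Proof.
by move/subnKC <-; elim: (n - m) => [|k IH]; rewrite ?addn0 // addnS; apply: leq_trans IH (num_avoiding_leS _).
Qed.

Lemma num_avoiding_le n :
  num_avoiding pat12453 n <= \sum_(k < n.+1) 'C(n, k) ^ 2 * size (completions (n - k) [::]).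
Proof. by apply: card_avoid12453_le => p; rewrite inE => /avoids_pat12453P. Qed.

Local Open Scope ring_scope.

(** * Enumeration of the words that avoid 1342 *)

Lemma coefs_eq0_dvdXn (R : comNzRingType) (p : {poly R}) n :
  (forall i, (i < n)%N -> p`_i = 0) -> exists q, p = 'X^n * q.
Proof.
move=> H; exists (drop_poly n p); rewrite -{1}(poly_take_drop n p) mulrC addrC.
rewrite (_ : take_poly n p = 0) ?addr0 //.
by apply/polyP => i; rewrite coef_take_poly coef0; case: ifP => // /H.
Qed.

(** * The quadratic equation with one catalytic variable *)

Section CatalyticEquation.
Variables (R : comNzRingType) (rho theta : R).
Hypothesis theta_inv : theta * (1 - 2 * rho) = 1.

Let Z := rho * (1 - 2 * rho).
Let r : {poly R} := rho%:P.
Let th : {poly R} := theta%:P.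
Let z : {poly R} := Z%:P.

(* Approximations of the power series [M] in ['X] with
   [(1 - 2 rho) M = rho 'X + 'X M + rho M^2]. *)
Fixpoint narayana n : {poly R} :=
  if n is n'.+1 then
    let M := narayana n' in th * (r * 'X + 'X * M + r * M ^+ 2)
  else 0.

Lemma narayana_factor n : exists M', narayana n = 'X * M'.
Proof.
elim: n => [|n [M' IH]] /=; first by exists 0; rewrite mulr0.
exists (th * (r + narayana n + r * M' * narayana n)); rewrite IH; ring.
Qed.

(** The iteration is an ['X]-adic contraction: a difference of successive terms is multiplied by
    ['X + r * (narayana n.+1 + narayana n)], up to the factor [th], and this is divisible by
    ['X]. *)
Lemma narayana_stable n : exists E, narayana n.+1 - narayana n = 'X^(n.+1) * E.
Proof.
elim: n => [|n [E IH]].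
  by exists (th * r); rewrite /= expr1; ring.
have [M1 H1] := narayana_factor n.+1; have [M0 H0] := narayana_factor n.
exists (th * (1 + r * (M1 + M0)) * E).
have -> : narayana n.+2 - narayana n.+1 =
   th * ('X + r * (narayana n.+1 + narayana n)) * (narayana n.+1 - narayana n).
  by rewrite /=; ring.
by rewrite IH H1 H0 !exprS; ring.
Qed.

Definition step_series n : {poly R} :=
  1 + th * (r * 'X - r * narayana n + 'X * narayana n).

(* [run_weight t] is the generating function in [Z] of the ways to read one decreasing
   run of [t] pending values together with everything inserted before its end;
   [step_weight t] counts those that start below the running minimum. *)
Definition step_weight t : R := (step_series t.+1)`_t.
Definition run_weight t : R := \sum_(i < t.+1) step_weight i.

Lemma step_series_coef t n : (t < n)%N -> (step_series n)`_t = step_weight t.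
Proof.
move=> tn; rewrite -(subnKC tn); elim: (n - _)%N => [|k IH]; first by rewrite addn0.
rewrite -IH addnS; have [E H] := narayana_stable (t.+1 + k).
apply/eqP; rewrite -subr_eq0 -coefB.
have -> : step_series (t.+1 + k).+1 - step_series (t.+1 + k) = 'X^((t.+1 + k).+1) * (th * ('X - r) * E).
  rewrite -mulrCA -H /step_series; ring.
by rewrite coefXnM ltnS (leq_trans (leqnSn t)) ?leq_addr.
Qed.

Lemma narayanaS n : exists Q, narayana n.+1 = 'X * (th * r + 'X * Q).
Proof.
have [M' HM] := narayana_factor n.
exists (th * (M' + r * M' ^+ 2)); rewrite /= HM; ring.
Qed.

Lemma step_weight0 : step_weight 0 = 1.
Proof.
rewrite /step_weight /step_series; have [Q ->] := narayanaS 0.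
set p := (X in 1 + X).
have -> : p = 'X * (th * (r - r * (th * r + 'X * Q) + 'X * (th * r + 'X * Q))).
  by rewrite /p; ring.
by rewrite coefD coefXM /= addr0 coef1.
Qed.

Lemma run_weight0 : run_weight 0 = 1.
Proof. by rewrite /run_weight big_ord_recl big_ord0 step_weight0 addr0. Qed.

Lemma run_weightS t : run_weight t.+1 = run_weight t + step_weight t.+1.
Proof. by rewrite /run_weight big_ord_recr. Qed.

Lemma step_weight1 : step_weight 1 = theta * rho - theta ^+ 2 * rho ^+ 2.
Proof.
rewrite /step_weight /step_series; have [Q ->] := narayanaS 1.
set p := (X in 1 + X).
have -> : p = 'X * ((theta * rho - theta ^+ 2 * rho ^+ 2)%:P +
    'X * (th * (th * r + 'X * Q - r * Q))).
  by rewrite /p polyCB !polyCM -/th -/r; ring.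
by rewrite coefD coefXM coefD coefXM coefC coef1 /= add0r addr0.
Qed.

(** Let 1 + H be the series of the step weights; that of the run weights is (1 + H) / (1 - X). The
    recursion becomes a quadratic equation for H with the further unknown [run_weight 1]. In terms
    of rho its discriminant is (X - rho)^2 times that of the equation for M in [narayana]; this is
    why H is linear in M with slope proportional to X - rho. *)
Lemma catalytic t : (0 < t)%N ->
  step_weight t = Z * (run_weight t + \sum_(j < t.+1) step_weight j.+1 * run_weight (t - j)).
Proof.
move=> t0.
pose T := t.+3.
pose M := narayana T.
have [E HE] := narayana_stable T.
have [M' HM'] := narayana_factor T.
pose H1 : {poly R} := th * (r - r * M' + M).
pose H := 'X * H1.
rewrite -/M in HM'.
have UH : step_series T = 1 + H by rewrite /step_series /H /H1 -/M HM'; ring.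
have Hu i : (i < T)%N -> (1 + H)`_i = step_weight i by rewrite -UH; exact: step_series_coef.
have H1u i : (i.+1 < T)%N -> H1`_i = step_weight i.+1.
  by move=> iT; rewrite -Hu // coefD coef1 /= add0r coefXM.
pose A := \poly_(i < T) run_weight i.
have Aa i : (i < T)%N -> A`_i = run_weight i by move=> iT; rewrite coef_poly iT.
have [Q HQ] : exists Q, (1 - 'X) * A = 1 + H + 'X^T * Q.
  have [|Q HQ] := @coefs_eq0_dvdXn _ ((1 - 'X) * A - (1 + H)) T.
    move=> i iT; rewrite coefB Hu // mulrBl mul1r coefB coefXM Aa //.
    case: i iT => [|i] iT /=; first by rewrite run_weight0 step_weight0 subr0 subrr.
    by rewrite Aa ?run_weightS; [ring|exact: ltnW].
  by exists Q; rewrite -HQ; ring.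
(* The two sides of the recursion, subtracted. The last term cancels the coefficient of ['X^0], for
   which the recursion is not claimed. *)
pose F := H - z * (A + H1 * A) + z * (run_weight 1)%:P.
have hk : th * (1 - 2 * r) = 1.
  by rewrite -[RHS](polyC1 R) -theta_inv polyCM polyCB polyCM polyC_natr.
have hz : z = r * (1 - 2 * r) by rewrite /z /Z polyCM polyCB polyCM polyC_natr.
have hH : (1 - 2 * r) * H = r * 'X - r * M + 'X * M.
  have -> : (1 - 2 * r) * H = th * (1 - 2 * r) * ('X * (r - r * M' + M)) by rewrite /H /H1; ring.
  by rewrite hk HM'; ring.
have ha : (1 - 2 * r) ^+ 2 * (run_weight 1)%:P = (1 - 2 * r) ^+ 2 + (1 - 2 * r) * r - r ^+ 2.
  rewrite run_weightS run_weight0 step_weight1 polyCD polyCB !polyCM -/th -/r.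
  have -> : (1 - 2 * r) ^+ 2 * (1%:P + (th * r - th ^+ 2 * r ^+ 2)) = (1 - 2 * r) ^+ 2 +
     th * (1 - 2 * r) * (1 - 2 * r) * r - (th * (1 - 2 * r)) ^+ 2 * r ^+ 2 by ring.
  by rewrite hk; ring.
have hM : (1 - 2 * r) * M - (r * 'X + 'X * M + r * M ^+ 2) = - (1 - 2 * r) * 'X^(T.+1) * E.
  rewrite -mulrA -HE [narayana T.+1]/= -/M.
  have -> : - (1 - 2 * r) * (th * (r * 'X + 'X * M + r * M ^+ 2) - M) =
    (1 - 2 * r) * M - th * (1 - 2 * r) * (r * 'X + 'X * M + r * M ^+ 2) by ring.
  by rewrite hk; ring.
(* Up to a multiple of ['X^T] this is ['X * (1 - 'X) * F]: the denominators of [H1 = H / 'X] and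
   [A = (1 + H) / (1 - 'X)] are cleared, which leaves a quadratic polynomial in [H]. *)
pose W := 'X * (1 - 'X) * H + 'X * (1 - 'X) * z * (run_weight 1)%:P - z * (1 + H) * ('X + H).
have key : (1 - 2 * r) ^+ 2 * W = (1 - 2 * r) ^+ 2 * (- ('X - r) ^+ 2 * 'X^(T.+1) * E).
  have -> : (1 - 2 * r) ^+ 2 * W = 'X * (1 - 'X) * (1 - 2 * r) * ((1 - 2 * r) * H) +
      'X * (1 - 'X) * z * ((1 - 2 * r) ^+ 2 * (run_weight 1)%:P) -
      z * ((1 - 2 * r) + (1 - 2 * r) * H) * ((1 - 2 * r) * 'X + (1 - 2 * r) * H).
    by rewrite /W; ring.
  have -> : (1 - 2 * r) ^+ 2 * (- ('X - r) ^+ 2 * 'X^(T.+1) * E) =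
      (1 - 2 * r) * ('X - r) ^+ 2 * (- (1 - 2 * r) * 'X^(T.+1) * E) by ring.
  by rewrite -hM hH ha hz; ring.
have WE : W = - ('X - r) ^+ 2 * 'X^(T.+1) * E.
  have cancel p : p = th ^+ 2 * ((1 - 2 * r) ^+ 2 * p).
    by rewrite mulrA -exprMn hk expr1n mul1r.
  by rewrite [LHS]cancel key -cancel.
have FE : 'X * ((1 - 'X) * F) = 'X^T * (- ('X - r) ^+ 2 * 'X * E - z * ('X + H) * Q).
  have -> : 'X * ((1 - 'X) * F) = 'X * (1 - 'X) * H + 'X * (1 - 'X) * z * (run_weight 1)%:P -
     z * ('X + H) * ((1 - 'X) * A) by rewrite /F /H; ring.
  have -> : 'X * (1 - 'X) * H + 'X * (1 - 'X) * z * (run_weight 1)%:P - z * ('X + H) * ((1 - 'X) * A) =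
     W - z * ('X + H) * ('X^T * Q) by rewrite HQ /W; ring.
  by rewrite WE (exprS _ T); ring.
have F0 i : (i < T.-1)%N -> F`_i = 0.
  have FX j : (j < T.-1)%N -> F`_j = if j == 0%N then 0 else F`_j.-1.
    move=> jT; have := congr1 (fun p : {poly R} => p`_j.+1) FE.
    have jT' : (j.+1 < T)%N := jT.
    rewrite coefXM coefXnM jT' /= mulrBl mul1r coefB coefXM.
    by move/eqP; rewrite subr_eq0 => /eqP.
  elim: i => [|i IH] iT; rewrite FX //= IH //; exact: ltnW.
have := F0 t (ltnW (ltnSn _)).
have tn0 : (t == 0)%N = false by case: (t) t0.
rewrite /F -/H coefD coefB !coefCM coefD (coefM H1) coefC tn0.
have -> : H`_t = step_weight t.
  by rewrite -Hu; [rewrite coefD coef1 tn0 add0r|rewrite /T; lia].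
rewrite Aa; last by rewrite /T; lia.
have -> : \sum_(j < t.+1) H1`_j * A`_(t - j) = \sum_(j < t.+1) step_weight j.+1 * run_weight (t - j).
  by apply: eq_bigr => i _; rewrite H1u ?Aa // /T; have := ltn_ord i; lia.
by rewrite mulr0 addr0 => /eqP; rewrite subr_eq0 => /eqP.
Qed.

End CatalyticEquation.

(** * Generating functions of completions as products of run weights *)

Section Enumeration.
Variables (R : comNzRingType) (rho theta : R).
Hypothesis theta_inv : theta * (1 - 2 * rho) = 1.

Let Z := rho * (1 - 2 * rho).
Let step_weight := step_weight rho theta.
Let run_weight := run_weight rho theta.

(** Pending runs are read in succession, and insertions take place only in the first one; hence the
    product. *)
Definition weight (ts : seq nat) : R := \prod_(t <- ts) run_weight t.
Definition weight_low (ts : seq nat) : R :=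
  if ts is t :: ts' then step_weight t * weight ts' else Z * run_weight 1.

Definition multZn (n : nat) (x : R) : Prop := exists y, x = Z ^+ n * y.

Lemma multZn_D n x y : multZn n x -> multZn n y -> multZn n (x + y).
Proof. by move=> [a1 ->] [b1 ->]; exists (a1 + b1); rewrite mulrDr. Qed.

Lemma multZn_sum n (k : nat) (F : 'I_k -> R) :
  (forall i, multZn n (F i)) -> multZn n (\sum_i F i).
Proof.
move=> H; apply: (big_ind (multZn n)) => //; last exact: multZn_D.
by exists 0; rewrite mulr0.
Qed.

Lemma weight_cons t ts : weight (t :: ts) = run_weight t * weight ts.
Proof. by rewrite /weight big_cons. Qed.

Lemma weight_split j ts : (j <= head 0%N ts)%N ->
  weight_low (split_run j ts) = step_weight j.+1 * (run_weight (head 0%N ts - j) * weight (behead ts)).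
Proof.
move=> lej; rewrite /split_run /=; congr (_ * _); case: eqP => [->|_].
  by rewrite /run_weight run_weight0 mul1r.
by rewrite weight_cons.
Qed.

(** The default [1] of [head] admits the empty list; only a first run of length 0, which [catalytic]
    does not cover, is excluded. *)
Lemma weight_low_rec ts : head 1%N ts != 0%N ->
  weight_low ts = Z * (weight ts + \sum_(j < (head 0%N ts).+1) weight_low (split_run j ts)).
Proof.
have E : \sum_(j < (head 0%N ts).+1) weight_low (split_run j ts) =
  (\sum_(j < (head 0%N ts).+1) step_weight j.+1 * run_weight (head 0%N ts - j)) * weight (behead ts).
  rewrite big_distrl; apply: eq_bigr => j _.
  by rewrite weight_split ?mulrA // -ltnS.
rewrite E {E}; case: ts => [|t ts] /= t0.
  rewrite big_ord1 /weight big_nil !mulr1 /run_weight /step_weight run_weightS run_weight0; congr (_ * _); ring.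
rewrite weight_cons -mulrDl mulrA /step_weight /run_weight; congr (_ * _).
by apply: catalytic; rewrite // lt0n.
Qed.

Lemma weight_full t ts :
  weight (t :: ts) = \sum_(i < t) weight_low (i.+1 :: ts) + weight ts.
Proof.
rewrite weight_cons; elim: t => [|t IH].
  by rewrite big_ord0 add0r /run_weight run_weight0 mul1r.
by rewrite big_ord_recr /= addrAC -IH /run_weight run_weightS mulrDl.
Qed.

(** The weights stop when the pending values are used up. What follows is a word with nothing
    pending, whose generating function is the inverse of [g]. *)
Let g := 1 - Z * run_weight 1.
Let psum (f : nat -> seq nat -> nat) m ts : R := \sum_(i < m) (f i ts)%:R * Z ^+ i.

Lemma psum_run_count_nil m : psum run_count m.+1 [::] = 1 + psum low_run_count m.+1 [::].
Proof.
rewrite /psum !big_ord_recl /= mul0r add0r expr0 mulr1.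
by congr (_ + _).
Qed.

Lemma psum_run_count_cons m t ts : psum run_count m (t :: ts) =
  \sum_(i < t) psum low_run_count m (i.+1 :: ts) + psum run_count m ts.
Proof.
rewrite /psum exchange_big /= -big_split /=; apply: eq_bigr => i _.
by rewrite run_count_cons natrD natr_sum mulrDl mulr_suml.
Qed.

Lemma psum_low_run_countS m ts : psum low_run_count m.+1 ts =
  Z * (psum run_count m ts + \sum_(j < (head 0%N ts).+1) psum low_run_count m (split_run j ts)).
Proof.
rewrite /psum big_ord_recl [low_run_count ord0 _]/= mul0r add0r exchange_big -big_split mulr_sumr.
apply: eq_bigr => i _; rewrite [nat_of_ord (lift _ _)]/= /bump add1n low_run_countS natrD natr_sum exprS.
by rewrite -mulr_suml /=; ring.
Qed.

Lemma weight_error m ts :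
  (forall ts', head 1%N ts' != 0%N -> multZn m (g * psum low_run_count m ts' - weight_low ts')) ->
  multZn m (g * psum run_count m ts - weight ts).
Proof.
case: m => [|m] low; first by exists (g * psum run_count 0 ts - weight ts); rewrite expr0 mul1r.
elim: ts => [|t ts IH].
  have := low [::] isT; rewrite psum_run_count_nil /weight big_nil /=.
  by congr multZn; rewrite /g; ring.
rewrite psum_run_count_cons weight_full.
have -> : g * (\sum_(i < t) psum low_run_count m.+1 (i.+1 :: ts) + psum run_count m.+1 ts) -
   (\sum_(i < t) weight_low (i.+1 :: ts) + weight ts) =
   \sum_(i < t) (g * psum low_run_count m.+1 (i.+1 :: ts) - weight_low (i.+1 :: ts)) +
   (g * psum run_count m.+1 ts - weight ts).
  by rewrite sumrB -mulr_sumr; ring.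
by apply: multZn_D => //; apply: multZn_sum => i; apply: low.
Qed.

(* The truncated generating function and the weight obey the same recursion,
   which multiplies by [Z]; hence their difference is divisible by every power
   of [Z]. *)
Lemma weight_low_error m ts : head 1%N ts != 0%N ->
  multZn m (g * psum low_run_count m ts - weight_low ts).
Proof.
elim: m ts => [|m IH] ts t0.
  by exists (g * psum low_run_count 0 ts - weight_low ts); rewrite expr0 mul1r.
rewrite psum_low_run_countS weight_low_rec //.
have H : multZn m ((g * psum run_count m ts - weight ts) + \sum_(j < (head 0%N ts).+1)
    (g * psum low_run_count m (split_run j ts) - weight_low (split_run j ts))).
  by apply: multZn_D; [exact: weight_error|apply: multZn_sum => j; exact: IH].
have [y Hy] := H; exists y; rewrite exprS -mulrA -Hy sumrB -mulr_sumr; ring.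
Qed.

Lemma completions_gf n : Z ^+ n = 0 ->
  (1 - Z * run_weight 1) * (\sum_(i < n) (size (completions i [::]))%:R * Z ^+ i) = 1.
Proof.
move=> Zn; have [y] := weight_error [::] (@weight_low_error n).
rewrite Zn mul0r /weight big_nil => /eqP; rewrite subr_eq0 => /eqP H.
rewrite -[RHS]H /g /psum; congr (_ * _); apply: eq_bigr => i _; by rewrite size_completions.
Qed.

End Enumeration.

(** Put rho = Z theta and reduce by 2 Z theta^2 = theta - 1. The factor 8 clears the denominators,
    and the result is linear in theta, so its coefficients can be read off. *)
Lemma completions_gf_theta (R : comNzRingType) (Z theta : R) n :
  theta = 1 + 2 * Z * theta ^+ 2 -> Z ^+ n = 0 ->
  (7 - 2 * Z + theta - 8 * Z * theta) *
    (\sum_(i < n) (size (completions i [::]))%:R * Z ^+ i) = 8.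
Proof.
move=> Ht Zn; pose rho := Z * theta.
have th_inv : theta * (1 - 2 * rho) = 1.
  have -> : theta * (1 - 2 * rho) = theta - 2 * Z * theta ^+ 2 by rewrite /rho; ring.
  by rewrite [X in X - _]Ht addrK.
have hZ : rho * (1 - 2 * rho) = Z.
  by rewrite -[RHS]mulr1 -[X in _ = _ * X]th_inv /rho; ring.
have := completions_gf th_inv (n := n); rewrite hZ => /(_ Zn).
set P := \sum_(i < n) _ => HP.
rewrite -[RHS]mulr1 -[X in _ = _ * X]HP mulrA; congr (_ * _).
have -> : run_weight rho theta 1 = 1 + theta * rho - theta ^+ 2 * rho ^+ 2.
  by rewrite run_weightS run_weight0 step_weight1; ring.
have e1 : 2 * Z * theta ^+ 2 = theta - 1 by rewrite [X in X - 1]Ht; ring.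
have -> : 8 * (1 - Z * (1 + theta * rho - theta ^+ 2 * rho ^+ 2)) =
  8 - Z * (8 + 4 * (2 * Z * theta ^+ 2) - 2 * (2 * Z * theta ^+ 2) ^+ 2).
  by rewrite /rho; ring.
rewrite e1.
have -> : 8 - Z * (8 + 4 * (theta - 1) - 2 * (theta - 1) ^+ 2) =
  8 - 2 * Z - 8 * Z * theta + 2 * Z * theta ^+ 2 by ring.
by rewrite e1; ring.
Qed.

(** * Catalan numbers and a renewal recurrence for S_n(1342) *)

Section Coefficients.
Variable R : realFieldType.

(* [cat2 i] is [2^i] times the [i]-th Catalan number. *)
Fixpoint cat2 (i : nat) : R :=
  if i is i'.+1 then cat2 i' * (4 * (2 * i'%:R + 1)) / (i'%:R + 2) else 1.

Lemma cat2_ratio i : (i%:R + 2) * cat2 i.+1 = 4 * (2 * i%:R + 1) * cat2 i.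
Proof. by have := ler0n R i => i0 /=; field; lra. Qed.

Lemma cat2_ge0 i : 0 <= cat2 i.
Proof.
elim: i => [|i IH] //=; have := ler0n R i => i0.
by apply: divr_ge0; [apply: mulr_ge0 => //; lra|lra].
Qed.

Lemma cat2_0 : cat2 0 = 1. Proof. by []. Qed.

Lemma cat2_1 : cat2 1 = 2. Proof. by rewrite /=; field. Qed.

Arguments cat2 : simpl never.

(* The first moment of the convolution is computed by its symmetry and by the
   ratio of consecutive terms. *)
Lemma cat2_conv n : 2 * \sum_(i < n.+1) cat2 i * cat2 (n - i) = cat2 n.+1.
Proof.
pose T n := \sum_(i < n.+1) cat2 i * cat2 (n - i).
pose M n := \sum_(i < n.+1) (i%:R + 1) * (cat2 i * cat2 (n - i)).
have M_sym k : 2 * M k = (k%:R + 2) * T k.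
  have E : M k = \sum_(i < k.+1) ((k - i)%:R + 1) * (cat2 i * cat2 (k - i)).
    rewrite /M (reindex_inj rev_ord_inj) /=; apply: eq_bigr => i _.
    by rewrite subSS subKn 1?[cat2 i * _]mulrC // -ltnS.
  rewrite mulr2n mulrDl mul1r {1}E /M -big_split /T mulr_sumr /=.
  by apply: eq_bigr => i _; rewrite natrB; [ring|rewrite -ltnS].
have M_step k : M k.+1 = cat2 k.+1 + 8 * M k - 4 * T k.
  rewrite /M big_ord_recl subn0 cat2_0 add0r !mul1r /T !mulr_sumr -addrA -sumrB.
  congr (_ + _); apply: eq_bigr => i _.
  rewrite lift0 subSS mulrA -[i.+1%:R]natr1.
  have := cat2_ratio i; rewrite (_ : i%:R + 2 = i%:R + 1 + 1); last by ring.
  by move=> ->; ring.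
rewrite -/(T n); elim: n => [|n IH].
  by rewrite /T big_ord1 subnn cat2_0 cat2_1; ring.
have H := M_sym n.+1; rewrite M_step in H.
have H1 := M_sym n; have H2 := cat2_ratio n.+1.
have n0 := ler0n R n.
have e : n.+1%:R = n%:R + 1 :> R by rewrite -natr1.
rewrite e in H H2.
apply: (@mulfI _ (n%:R + 3)); first by apply: lt0r_neq0; lra.
have -> : (n%:R + 3) * cat2 n.+2 = 4 * (2 * (n%:R + 1) + 1) * cat2 n.+1 by rewrite -H2; ring.
have -> : (n%:R + 3) * (2 * T n.+1) = 2 * (2 * (cat2 n.+1 + 8 * M n - 4 * T n)) by rewrite H; ring.
have -> : 2 * (2 * (cat2 n.+1 + 8 * M n - 4 * T n)) =
  4 * cat2 n.+1 + 16 * (2 * M n) - 8 * (2 * T n) by ring.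
rewrite H1.
have -> : 16 * ((n%:R + 2) * T n) = 8 * (n%:R + 2) * (2 * T n) by ring.
by rewrite IH; ring.
Qed.

Definition num1342 (n : nat) : R := (size (completions n [::]))%:R.

(* Eight times the number of skew-indecomposable 1342-avoiding words of length
   [i+1]. *)
Definition renewal_coef (i : nat) : R := 8 * cat2 i - cat2 i.+1 + (i == 0)%:R * 2.

(** [completions_gf_theta] is applied in R[X] modulo X^(N+1), with the nilpotent class of X for Z
    and the truncated series of [cat2] for theta. There [L] is 8 minus the sum of [renewal_coef i]
    X^(i+1), and the recurrence is the coefficient of X^N. *)
Lemma num1342_rec n :
  8 * num1342 n.+1 = \sum_(i < n.+1) renewal_coef i * num1342 (n - i).
Proof.
pose N := n.+1.
pose Th : {poly R} := \poly_(i < N.+1) cat2 i.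
pose P : {poly R} := \sum_(i < N.+1) (num1342 i)%:P * 'X^i.
pose f : {rmorphism {poly R} -> {poly %/ 'X^(N.+1)}} :=
  in_qpoly ('X^(N.+1) : {poly R}).
have mkX : mk_monic ('X^(N.+1) : {poly R}) = 'X^(N.+1) by rewrite mk_monic_Xn.
have f_eq0 p : f p = 0 -> exists q, p = 'X^(N.+1) * q.
  move=> /(congr1 val) /= H; exists (rdivp p 'X^(N.+1)).
  by rewrite mkX in H; rewrite {1}(rdivp_eq (monicXn R N.+1) p) H addr0 mulrC.
have fX0 q : f ('X^(N.+1) * q) = 0.
  rewrite rmorphM /= (_ : f 'X^(N.+1) = 0) ?mul0r //.
  by apply: val_inj => /=; rewrite mkX rmodpp // monicXn.
have HTh : f Th = 1 + 2 * f 'X * f Th ^+ 2.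
  have [|q Hq] := @coefs_eq0_dvdXn _ (Th - 1 - 2 * 'X * Th ^+ 2) N.+1.
    move=> i iN; rewrite !coefB coef1 -mulrA mulr_natl coefMn coefXM.
    case: i iN => [|i] iN; first by rewrite coef_poly /= cat2_0 mul0rn; ring.
    rewrite coef_poly iN -cat2_conv expr2 coefM /= subr0.
    rewrite (_ : \sum_(j < i.+1) Th`_j * Th`_(i - j) = \sum_(j < i.+1) cat2 j * cat2 (i - j)) ?mulr_natl ?subrr //.
    apply: eq_bigr => j _; rewrite !coef_poly.
    by rewrite (leq_trans (ltn_ord j)) ?(leq_ltn_trans (leq_subr _ _)) // ltnW.
  have := fX0 q; rewrite -Hq expr2 !(rmorphB, rmorphM, rmorph1, rmorph_nat) -expr2.
  by move/eqP; rewrite subr_eq0 subr_eq addrC => /eqP.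
have HX : f 'X ^+ N.+1 = 0 by rewrite -rmorphXn; have := fX0 1; rewrite mulr1.
pose L : {poly R} := 7 - 2 * 'X + Th - 8 * 'X * Th.
have HL : f (L * P - 8) = 0.
  have := completions_gf_theta HTh HX.
  have -> : \sum_(i < N.+1) (size (completions i [::]))%:R * f 'X ^+ i = f P.
    rewrite rmorph_sum; apply: eq_bigr => i _.
    by rewrite rmorphM rmorphXn /num1342 polyC_natr rmorph_nat.
  rewrite /L !(rmorph_nat, rmorphM, rmorphB, rmorphD) => ->.
  exact: subrr.
have [q Hq] := f_eq0 _ HL.
have : (L * P - 8)`_N = 0 by rewrite Hq coefXnM ltnSn.
have PE i : (i <= N)%N -> P`_i = num1342 i.
  move=> iN; rewrite /P coef_sum (bigD1 (Ordinal (iN : (i < N.+1)%N))) //=.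
  rewrite coefCM coefXn eqxx mulr1 big1 ?addr0 // => j ji.
  rewrite coefCM coefXn; case: eqP => [e|]; last by rewrite mulr0.
  by case/eqP: ji; apply: val_inj; rewrite /= e.
have LE i : L`_i = 7 * (i == 0)%:R - 2 * (i == 1)%:R + Th`_i - 8 * (if i == 0%N then 0 else Th`_i.-1).
  by rewrite /L !coefD !coefN -mulrA !mulr_natl !coefMn coefXM coefX coef1; case: (i == 0)%N; ring.
rewrite coefB -[8]polyC_natr coefC subr0 coefM big_ord_recl LE /= subn0 PE //.
rewrite [Th`__]coef_poly /= cat2_0 => H.
have -> : 8 * num1342 N = - \sum_(i < N) L`_(bump 0 i) * P`_(N - bump 0 i).
  have e : 7 * 1 - 2 * 0 + 1 - 8 * 0 = 8 :> R by ring.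
  by apply/eqP; rewrite -addr_eq0; rewrite e in H; rewrite H.
rewrite -sumrN; apply: eq_bigr => i _.
have iN := ltn_ord i; rewrite /bump add1n subSS PE; last by rewrite (leq_trans (leq_subr _ _)).
have iN' : (i < N.+1)%N := ltnW iN; have iN2 : (i.+1 < N.+1)%N := iN.
rewrite LE ![Th`__]coef_poly iN2 /= iN' eqSS.
by rewrite -mulNr /renewal_coef; congr (_ * _); ring.
Qed.

Lemma renewal_coefE i : (i%:R + 2) * renewal_coef i = 12 * cat2 i + (i == 0)%:R * 4.
Proof.
rewrite /renewal_coef; have -> : (i%:R + 2) * (8 * cat2 i - cat2 i.+1 + (i == 0)%:R * 2) =
  (i%:R + 2) * 8 * cat2 i - (i%:R + 2) * cat2 i.+1 + (i%:R + 2) * ((i == 0)%:R * 2) by ring.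
by rewrite cat2_ratio; case: i => [|i] /=; ring.
Qed.

Lemma renewal_coef_ge0 i : 0 <= renewal_coef i.
Proof.
have i0 := ler0n R i; have c0 := cat2_ge0 i.
rewrite -(@pmulr_rge0 _ (i%:R + 2)); last by lra.
rewrite renewal_coefE; apply: addr_ge0; first by apply: mulr_ge0.
by apply: mulr_ge0 => //; exact: ler0n.
Qed.

(** After weighting by powers of 8 the differences 8 [cat2 i] - [cat2 i.+1] telescope. The induction
    for S_n(1342) <= 8^n only needs 64 in place of 10. *)
Lemma renewal_coef_sum n : \sum_(i < n.+1) renewal_coef i * 8 ^+ (n - i) <= 10 * 8 ^+ n.
Proof.
suff -> : \sum_(i < n.+1) renewal_coef i * 8 ^+ (n - i) = 10 * 8 ^+ n - cat2 n.+1.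
  by rewrite lerBlDr lerDl cat2_ge0.
elim: n => [|n IH].
  by rewrite big_ord1 /renewal_coef subnn !expr0 cat2_0 cat2_1 /=; ring.
rewrite big_ord_recr /= subnn expr0 mulr1.
have -> : \sum_(i < n.+1) renewal_coef i * 8 ^+ (n.+1 - i) =
   8 * \sum_(i < n.+1) renewal_coef i * 8 ^+ (n - i).
  rewrite mulr_sumr; apply: eq_bigr => i _.
  by rewrite subSn ?exprS; [ring|rewrite -ltnS].
by rewrite IH /renewal_coef /= exprS; ring.
Qed.

Lemma num1342_0 : num1342 0 = 1.
Proof. by []. Qed.

Lemma num1342_ub n : num1342 n <= 8 ^+ n.
Proof.
elim/ltn_ind: n => -[|n] IH; first by rewrite num1342_0 expr0.
rewrite -(@ler_pM2l _ 8) // num1342_rec.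
apply: le_trans (le_trans _ (renewal_coef_sum n)) _.
  apply: ler_sum => i _; apply: ler_wpM2l; first exact: renewal_coef_ge0.
  by apply: IH; rewrite ltnS leq_subr.
have : 0 <= 8 ^+ n :> R by exact: exprn_ge0.
by rewrite exprS; lra.
Qed.

Lemma num1342_ge0 n : 0 <= num1342 n.
Proof. exact: ler0n. Qed.

(** A single term of the recurrence already has the exponential order 8^n, so the others are
    discarded. *)
Lemma renewal_coef_le n : renewal_coef n <= 8 * num1342 n.+1.
Proof.
rewrite num1342_rec (bigD1 ord_max) //= subnn num1342_0 mulr1 lerDl.
by apply: sumr_ge0 => i _; apply: mulr_ge0; [exact: renewal_coef_ge0|exact: num1342_ge0].
Qed.

(** The true order of [cat2 i] is 8^i i^(-3/2); the cruder quadratic factor lets the ratio of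
    consecutive terms carry an induction. *)
Lemma cat2_lb i : 8 ^+ i.+1 <= 2 * (i%:R + 1) * (i%:R + 2) * cat2 i.+1.
Proof.
elim: i => [|i IH]; first by rewrite cat2_1 expr1; lra.
have i0 := ler0n R i; have c0 := cat2_ge0 i.+1; rewrite exprS.
have H := cat2_ratio i.+1.
have e : i.+1%:R = i%:R + 1 :> R by rewrite -natr1.
rewrite e in H *.
have -> : 2 * (i%:R + 1 + 1) * (i%:R + 1 + 2) * cat2 i.+2 =
   2 * (i%:R + 2) * ((i%:R + 1 + 2) * cat2 i.+2) by ring.
rewrite H.
have : 0 <= (i%:R + 2) * cat2 i.+1 by apply: mulr_ge0 => //; lra.
by nra.
Qed.

Lemma num1342_lb n : 8 ^+ n <= 16 * (n%:R + 1) ^+ 3 * num1342 n.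
Proof.
case: n => [|[|n]].
- by rewrite num1342_0 expr0; lra.
- have := renewal_coef_le 0; rewrite /renewal_coef cat2_0 cat2_1 /= !expr1; lra.
have n0 := ler0n R n; have c0 := cat2_ge0 n.+1.
have H1 := renewal_coef_le n.+1; have H2 := renewal_coefE n.+1; have H3 := cat2_lb n.
have e : n.+2%:R = n%:R + 2 :> R by rewrite -addn2 natrD.
have e1 : n.+1%:R = n%:R + 1 :> R by rewrite -natr1.
rewrite e1 mul0r addr0 in H2; rewrite e exprS.
have H4 : 12 * cat2 n.+1 <= 8 * (n%:R + 3) * num1342 n.+2.
  rewrite -H2; have -> : 8 * (n%:R + 3) * num1342 n.+2 = (n%:R + 1 + 2) * (8 * num1342 n.+2) by ring.
  by apply: ler_wpM2l => //; lra.
have H5 : 3 * 8 ^+ n.+1 <= 4 * (n%:R + 1) * (n%:R + 2) * (n%:R + 3) * num1342 n.+2.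
  have : (n%:R + 1) * (n%:R + 2) * (12 * cat2 n.+1) <= (n%:R + 1) * (n%:R + 2) * (8 * (n%:R + 3) * num1342 n.+2).
    by apply: ler_wpM2l => //; nra.
  by lra.
have H6 : 4 * (n%:R + 1) * (n%:R + 2) * (n%:R + 3) * num1342 n.+2 <= 4 * (n%:R + 3) ^+ 3 * num1342 n.+2.
  apply: ler_wpM2r; first exact: num1342_ge0.
  by nra.
by have := exprn_ge0 n.+1 (ler0n R 8); have := num1342_ge0 n.+2; lra.
Qed.

End Coefficients.

(** * The growth rate *)

Section Bounds.
Variable R : realType.

Lemma num_avoiding_ub n : (num_avoiding pat12453 n)%:R <= ((1 + Num.sqrt 8) ^+ 2) ^+ n :> R.
Proof.
set v : R := Num.sqrt 8.
have v0 : 0 <= v by exact: sqrtr_ge0.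
have v2 : v ^+ 2 = 8 by rewrite sqr_sqrtr.
have -> : ((1 + v) ^+ 2) ^+ n = (\sum_(k < n.+1) v ^+ (n - k) *+ 'C(n, k)) ^+ 2.
  rewrite exprAC [1 + v]addrC exprDn; congr (_ ^+ 2).
  by apply: eq_bigr => i _; rewrite expr1n mulr1.
(* For nonnegative terms the sum of the squares is at most the square of the sum. *)
apply: (@le_trans _ _ (\sum_(k < n.+1) (v ^+ (n - k) *+ 'C(n, k)) ^+ 2)).
  apply: le_trans (_ : (\sum_(k < n.+1) 'C(n, k) ^ 2 * size (completions (n - k) [::]))%:R <= _).
    by rewrite ler_nat num_avoiding_le.
  rewrite natr_sum; apply: ler_sum => k _.
  have -> : (v ^+ (n - k) *+ 'C(n, k)) ^+ 2 = ('C(n, k))%:R ^+ 2 * 8 ^+ (n - k).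
    by rewrite -mulr_natl exprMn exprAC v2.
  rewrite natrM natrX; apply: ler_wpM2l; first exact: exprn_ge0.
  exact: num1342_ub.
have F0 (k : 'I_n.+1) : 0 <= v ^+ (n - k) *+ 'C(n, k) by rewrite mulrn_wge0 ?exprn_ge0.
rewrite [X in _ <= X]expr2 mulr_suml; apply: ler_sum => k _.
rewrite expr2; apply: ler_wpM2l => //.
by rewrite (bigD1 k) //= lerDl sumr_ge0.
Qed.

(** Bernoulli's inequality for the fourth root 1 + h of q gives q^n >= (n h)^4, and degree 4 beats
    degree 3. The 8 in [N] comes from (n + 1)^3 <= (2 n)^3. *)
Lemma cube_le_expn (q C : R) : 1 < q -> exists N, forall n, (N <= n)%N -> C * (n%:R + 1) ^+ 3 <= q ^+ n.
Proof.
move=> q1; pose s := Num.sqrt (Num.sqrt q).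
have q0 : 0 <= q by lra.
have s0 : 0 <= s by exact: sqrtr_ge0.
have s4 : s ^+ 4 = q by rewrite (exprM s 2 2) sqr_sqrtr ?sqrtr_ge0 // sqr_sqrtr.
have s1 : 1 < s by rewrite ltNge; apply/negP => /(exprn_ile1 4 s0); rewrite s4; lra.
pose h := s - 1; have h0 : 0 < h by rewrite /h; lra.
pose D := Num.max C 0.
have D0 : 0 <= D by rewrite /D le_max lexx orbT.
have CD : C <= D by rewrite /D le_max lexx.
pose N := (Num.truncn (8 * D / h ^+ 4)).+1.
exists N => n Nn.
have n1 : 1 <= n%:R :> R by rewrite ler1n; apply: leq_trans Nn.
have bern m : 1 + m%:R * h <= s ^+ m.
  elim: m => [|m IH]; first by rewrite expr0 mul0r addr0.
  have e : s = 1 + h by rewrite /h; ring.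
  have m0 := ler0n R m.
  have h2 : 0 <= m%:R * h * h by rewrite !mulr_ge0 // ltW.
  have h3 : (1 + h) * (1 + m%:R * h) <= (1 + h) * s ^+ m by apply: ler_wpM2l => //; lra.
  by rewrite exprS [X in _ <= X * _]e -natr1; lra.
have qn : (n%:R * h) ^+ 4 <= q ^+ n.
  rewrite -s4 exprAC; apply: lerXn2r; rewrite ?nnegrE.
  - by apply: mulr_ge0; lra.
  - by apply: exprn_ge0; lra.
  by have := bern n; lra.
have nD : 8 * D <= n%:R * h ^+ 4.
  rewrite -ler_pdivrMr ?exprn_gt0 //.
  apply: ltW; apply: lt_le_trans (_ : N%:R <= _); last by rewrite ler_nat.
  exact: truncnS_gt.
apply: le_trans qn.
have h3 : C * (n%:R + 1) ^+ 3 <= D * (2 * n%:R) ^+ 3.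
  apply: le_trans (_ : D * (n%:R + 1) ^+ 3 <= _).
    by apply: ler_wpM2r => //; apply: exprn_ge0; lra.
  by apply: ler_wpM2l => //; apply: lerXn2r; rewrite ?nnegrE; lra.
apply: le_trans h3 _.
have -> : D * (2 * n%:R) ^+ 3 = n%:R ^+ 3 * (8 * D) by ring.
have -> : (n%:R * h) ^+ 4 = n%:R ^+ 3 * (n%:R * h ^+ 4) by ring.
by apply: ler_wpM2l => //; apply: exprn_ge0; lra.
Qed.

Lemma num1342_growth (y : R) : 1 <= y -> y < 8 ->
  exists2 t, (0 < t)%N & y ^+ t <= (size (completions t [::]))%:R.
Proof.
move=> y1 y8; have y0 : 0 < y by lra.
have [|N HN] := @cube_le_expn (8 / y) 16; first by rewrite ltr_pdivlMr // mul1r.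
exists N.+1 => //.
have := HN N.+1 (leqnSn N); rewrite expr_div_n ler_pdivlMr ?exprn_gt0 // => h.
have h2 := le_trans h (num1342_lb R N.+1).
rewrite -(@ler_pM2l _ (16 * (N.+1%:R + 1) ^+ 3)) //; exact: h2.
Qed.

(** The largest of the n + 1 terms of the binomial expansion is at least their average. *)
Lemma large_term (v : R) n : 0 <= v ->
  exists2 k, (k <= n)%N & (1 + v) ^+ n <= (n%:R + 1) * ('C(n, k)%:R * v ^+ (n - k)).
Proof.
move=> v0; apply: contrapT => H.
have lt (k : 'I_n.+1) : (n%:R + 1) * ('C(n, k)%:R * v ^+ (n - k)) < (1 + v) ^+ n.
  by rewrite ltNge; apply/negP => h; apply: H; exists k => //; rewrite -ltnS.
have : \sum_(k < n.+1) (n%:R + 1) * ('C(n, k)%:R * v ^+ (n - k)) <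
       \sum_(k < n.+1) (1 + v) ^+ n by apply: ltr_sum => //; apply/hasP; exists ord0; rewrite // mem_index_enum.
rewrite -mulr_sumr sumr_const card_ord -[X in _ < X]mulr_natl -natr1.
have -> : \sum_(k < n.+1) ('C(n, k)%:R * v ^+ (n - k)) = (1 + v) ^+ n.
  rewrite addrC exprDn; apply: eq_bigr => k _; by rewrite expr1n mulr1 mulr_natl.
by rewrite ltxx.
Qed.

Lemma num_avoiding_lb (v beta : R) : 1 <= v -> v < Num.sqrt 8 -> 0 < beta ->
  beta < (1 + v) ^+ 2 ->
  exists N, forall n, (N <= n)%N -> beta ^+ n <= (num_avoiding pat12453 n)%:R.
Proof.
move=> v1 v8 b0 bv; have v0 : 0 <= v by lra.
have y8 : v ^+ 2 < 8.
  by rewrite -[X in _ < X](sqr_sqrtr (a := 8)) // ltrXn2r // ?nnegrE ?sqrtr_ge0.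
have y1 : 1 <= v ^+ 2 by rewrite expr_ge1.
have [t t0 St] := num1342_growth y1 y8.
pose q := (1 + v) ^+ 2 / beta; have q1 : 1 < q by rewrite ltr_pdivlMr ?mul1r.
(* At most [2 * t + 3] letters are spent on padding and do not enter the binomial estimate; this
   constant pays for them. *)
have [N HN] := cube_le_expn ((1 + v) ^+ (2 * (2 * t + 3))) q1.
exists (N + (2 * t + 3))%N => n Nn.
have {}HN := HN n (leq_trans (leq_addr _ _) Nn).
have [n0 nE] : exists n0, n = (n0 + (2 * t + 3))%N.
  by exists (n - (2 * t + 3))%N; rewrite subnK // (leq_trans (leq_addl _ _) Nn).
have [k kn hk] := large_term n0 v0.
have [m km] : exists m, (k + m)%N = n0 by exists (n0 - k)%N; exact: subnKC.
have nkm : (n0 - k)%N = m by rewrite -km addKn.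
rewrite nkm in hk.
(* Enough blocks for a lead of at least [t], but so few that the woven words have length at most
   [n]. *)
have [b slack bt] : exists2 b, (m + t <= b * t)%N & (b * t <= m + 2 * t)%N.
  exists (m %/ t + 2)%N; rewrite mulnDl; first by have := ltn_ceil m t0; rewrite mulSn; lia.
  by rewrite leq_add2r leq_divM.
have [L [uL avL sL]] := exists_avoiders k slack.
have leL : (size L <= num_avoiding pat12453 n)%N.
  apply: leq_trans (num_avoiding_ge uL avL) _; apply: num_avoiding_mono.
  by clear - bt km nE; lia.
rewrite km in sL.
set c : R := (num_avoiding pat12453 n)%:R.
have c0 : 0 <= c by exact: ler0n.
have n00 := ler0n R n0.
have kn1 : k.+1%:R <= n0%:R + 1 :> R by rewrite natr1 ler_nat.
have h1 : ('C(n0, k)%:R * v ^+ m) ^+ 2 <= (n0%:R + 1) * c.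
  apply: (@le_trans _ _ (k.+1%:R * (size L)%:R)).
    rewrite -natrM; apply: le_trans (_ : ('C(n0, k) ^ 2 * size (completions t [::]) ^ b)%:R <= _); last by rewrite ler_nat.
    rewrite exprMn natrM !natrX; apply: ler_wpM2l; first exact: exprn_ge0.
    (* Since [v >= 1], the exponent may grow from [m] to [t * b]. *)
    apply: (@le_trans _ _ ((v ^+ 2) ^+ (t * b))).
      rewrite [X in X <= _]exprAC; apply: ler_weXn2l => //; rewrite mulnC; clear - slack; lia.
    by rewrite exprM; apply: lerXn2r; rewrite ?nnegrE ?exprn_ge0.
  by apply: ler_pM => //; rewrite ler_nat.
(* Two factors [n0 + 1] come from squaring the largest term, the third from the loss by
   rotations. *)
have h2 : ((1 + v) ^+ n0) ^+ 2 <= (n0%:R + 1) ^+ 3 * c.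
  apply: le_trans (_ : ((n0%:R + 1) * ('C(n0, k)%:R * v ^+ m)) ^+ 2 <= _).
    have vm0 : 0 <= 'C(n0, k)%:R * v ^+ m by rewrite mulr_ge0 // exprn_ge0.
    apply: lerXn2r; rewrite ?nnegrE //; first by apply: exprn_ge0; lra.
    by apply: mulr_ge0 => //; lra.
  have -> : (n0%:R + 1) ^+ 3 * c = (n0%:R + 1) ^+ 2 * ((n0%:R + 1) * c) by ring.
  by rewrite exprMn; apply: ler_wpM2l => //; apply: exprn_ge0; lra.
have n0n : n0%:R <= n%:R :> R by rewrite ler_nat nE leq_addr.
have h3 : ((1 + v) ^+ n0) ^+ 2 <= (n%:R + 1) ^+ 3 * c.
  apply: le_trans h2 _; apply: ler_wpM2r => //; apply: lerXn2r; rewrite ?nnegrE; lra.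
have v10 : 0 < 1 + v by lra.
have qb : q ^+ n * beta ^+ n = ((1 + v) ^+ 2) ^+ n.
  by rewrite -exprMn divfK // lt0r_neq0.
have h4 : ((1 + v) ^+ 2) ^+ n = (1 + v) ^+ (2 * (2 * t + 3)) * ((1 + v) ^+ n0) ^+ 2.
  rewrite -!exprM -exprD; congr (_ ^+ _); clear - nE; lia.
have h5 : q ^+ n * beta ^+ n <= q ^+ n * c.
  rewrite qb h4; apply: le_trans (_ : (1 + v) ^+ (2 * (2 * t + 3)) * ((n%:R + 1) ^+ 3 * c) <= _).
    by apply: ler_wpM2l => //; apply: exprn_ge0; lra.
  by rewrite mulrA; apply: ler_wpM2r.
by rewrite -(@ler_pM2l _ (q ^+ n)) // exprn_gt0 //; lra.
Qed.

Lemma avoiding_root_le (beta : R) n : 0 <= beta -> (0 < n)%N ->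
  (num_avoiding pat12453 n)%:R <= beta ^+ n -> avoiding_root R pat12453 n <= beta.
Proof.
move=> b0 n0 h.
have -> : beta = (beta ^+ n) `^ n%:R^-1.
  by rewrite -powR_mulrn // -powRrM divff ?powRr1 // pnatr_eq0 -lt0n.
by apply: ge0_ler_powR; rewrite ?nnegrE ?invr_ge0 ?exprn_ge0.
Qed.

Lemma avoiding_root_ge (beta : R) n : 0 <= beta -> (0 < n)%N ->
  beta ^+ n <= (num_avoiding pat12453 n)%:R -> beta <= avoiding_root R pat12453 n.
Proof.
move=> b0 n0 h.
have -> : beta = (beta ^+ n) `^ n%:R^-1.
  by rewrite -powR_mulrn // -powRrM divff ?powRr1 // pnatr_eq0 -lt0n.
by apply: ge0_ler_powR; rewrite ?nnegrE ?invr_ge0 ?exprn_ge0.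
Qed.

Lemma avoiding_root_cvg :
  (avoiding_root R pat12453 @ \oo --> (1 + Num.sqrt 8 : R) ^+ 2)%classic.
Proof.
set B := (1 + Num.sqrt 8 : R) ^+ 2.
have s0 : 0 <= Num.sqrt 8 :> R by exact: sqrtr_ge0.
have s2 : (Num.sqrt 8) ^+ 2 = 8 :> R by rewrite sqr_sqrtr.
have s1 : 2 < Num.sqrt 8 :> R.
  by rewrite ltNge; apply/negP => h; have : (Num.sqrt 8) ^+ 2 <= 2 ^+ 2 :> R;
   [apply: lerXn2r; rewrite ?nnegrE|rewrite s2; lra].
have B0 : 0 <= B by exact: exprn_ge0; lra.
apply/cvgrPdist_le => eps eps0.
pose eta := Num.min eps 1.
have eta0 : 0 < eta by rewrite lt_min eps0 ltr01.
have eta1 : eta <= 1 by rewrite ge_min lexx orbT.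
have etae : eta <= eps by rewrite ge_min lexx.
(* The derivative of (1 + x)^2 at sqrt 8 is 2 (1 + sqrt 8) < 8, so lowering x by eta / 8 costs less
   than eta. *)
pose v := Num.sqrt 8 - eta / 8.
have s3 : Num.sqrt 8 < 3 :> R by nra.
have v1 : 1 <= v by rewrite /v; lra.
have v8 : v < Num.sqrt 8 by rewrite /v; lra.
have b0 : 0 < B - eta by rewrite /B; nra.
have bv : B - eta < (1 + v) ^+ 2 by rewrite /B /v; nra.
have [N HN] := num_avoiding_lb v1 v8 b0 bv.
near=> n.
have n0 : (0 < n)%N by near: n; exists 1%N.
have Nn : (N <= n)%N by near: n; exists N.
have lo := avoiding_root_ge (ltW b0) n0 (HN n Nn).
have hi := avoiding_root_le B0 n0 (num_avoiding_ub n).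
by rewrite ger0_norm; lra.
Unshelve. all: by end_near.
Qed.

End Bounds.

Theorem theorem4p1 (R : realType) :
  [/\ cvgn (avoiding_root R pat12453),
      growth_rate R pat12453 = (1 + Num.sqrt 8) ^+ 2
    & (1 + Num.sqrt 8) ^+ 2 = 9 + 4 * Num.sqrt 2 :> R].
Proof.
split.
- by apply/cvg_ex; exists ((1 + Num.sqrt 8) ^+ 2); exact: avoiding_root_cvg.
- by apply/cvg_lim => //; exact: avoiding_root_cvg.
have -> : Num.sqrt 8 = 2 * Num.sqrt 2 :> R.
  have -> : 8 = 2 ^+ 2 * 2 :> R by ring.
  by rewrite sqrtrM ?exprn_ge0 // sqrtr_sqr ger0_norm.
have e : (Num.sqrt 2) ^+ 2 = 2 :> R by rewrite sqr_sqrtr.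
have -> : (1 + 2 * Num.sqrt 2) ^+ 2 = 1 + 4 * Num.sqrt 2 + 4 * (Num.sqrt 2) ^+ 2 :> R by ring.
by rewrite e; ring.
Qed.
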